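(* For each integer $n\ge 2$ let $X_n$ be a random tree on the node set $\{1,\dots,n\}$ with distribution $\Pi_n$. Then the sequence $(X_n)$ has a random local limit which is an infinite rooted random tree; that is, there is a probability distribution $\rho$ on rooted graphs, concentrated on infinite rooted trees, such that for every positive integer $R$, every finite rooted graph $F$ and every $\epsilon>0$, $$\lim_{n\to\infty}\mathbb{P}\bigl(|p(R,F,U(X_n))-p(R,F,\rho)|>\epsilon\bigr)=0.$$
   Context: For $n\ge 2$, $\Pi_n$ is the probability distribution on the set of all (labeled) trees $T$ with node set $\{1,\dots,n\}$ given by $$\Pi_n(T)=\frac{\prod_{i=1}^n d_i!}{(n-2)!\binom{3n-3}{n-2}},$$ where $d_i$ is the degree of node $i$ in $T$. For a graph $G$ and a node $v$, $B_G(v,R)$ is the rooted $R$-ball around $v$: the subgraph induced by the nodes at distance at most $R$ from $v$, rooted at $v$. For a probability distribution $\rho$ on rooted graphs, a positive integer $R$ and a finite rooted graph $F$, $p(R,F,\rho)$ is the probability that $F$ is isomorphic, as a rooted graph, to the $R$-ball around the root of a rooted graph chosen with distribution $\rho$. For a finite graph $G$, $U(G)$ is the distribution of the rooted graph obtained by choosing a uniform random node of $G$ as the root. In the displayed limit the outer probability is with respect to the random tree $X_n$. A sequence $(G_n)$ of random finite graphs has random local limit $\rho$ if for every positive integer $R$, every finite rooted graph $F$ and every $\epsilon>0$, $\lim_{n\to\infty}\mathbb{P}(|p(R,F,U(G_n))-p(R,F,\rho)|>\epsilon)=0$. *)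

(* Defs.v *)
From HB Require Import structures.
From mathcomp Require Import all_boot all_order all_algebra.
From mathcomp Require Import finmap.
From mathcomp Require Import all_classical all_reals all_analysis.

Set Implicit Arguments.
Unset Strict Implicit.
Unset Printing Implicit Defensive.

Import Order.TTheory GRing.Theory Num.Theory.
Import numFieldNormedType.Exports.

Local Open Scope classical_set_scope.
Local Open Scope ring_scope.

(* Simple undirected graphs whose nodes are labelled by natural numbers; every
   countable graph is isomorphic to one of these. No local finiteness or
   connectedness is imposed. *)
Record sgraph := SGraph {
  nodes : set nat;
  adj : rel nat;
  adj_sym : symmetric adj;
  adj_irr : irreflexive adj;
  adj_nodes : forall u v, adj u v -> nodes u }.

Record rooted_graph := RootedGraph {
  rg_graph :> sgraph;
  groot : nat;
  groot_node : nodes rg_graph groot }.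

Section Graphs.
Implicit Types (G : sgraph) (H F : rooted_graph).

Definition gconnected G : Prop :=
  forall u v, nodes G u -> nodes G v -> exists2 p, path (adj G) u p & last u p = v.

(* Repetition-free closed walks of length 1 and 2 are not cycles of a simple
   graph, whence the size condition. *)
Definition gacyclic G : Prop :=
  forall c : seq nat, (2 < size c)%N -> ~ ucycle (adj G) c.

Definition is_tree G : Prop :=
  [/\ nodes G !=set0, gconnected G & gacyclic G].

Definition infinite_rooted_tree H : Prop :=
  infinite_set (nodes H) /\ is_tree H.

(* A node set that is infinite at v gives degree 0, [fset_set] being empty on
   infinite sets; the degree is only used for finite graphs. *)
Definition degree G (v : nat) : nat := #|` fset_set [set u | adj G v u] |.

Definition within_dist G (r u v : nat) : Prop :=
  exists p, [/\ path (adj G) u p, last u p = v & (size p <= r)%N].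

End Graphs.

Section Induced.
Variables (G : sgraph) (S : set nat).

Let iadj : rel nat := fun u v => [&& u \in S, v \in S & adj G u v].

Let iadj_sym : symmetric iadj.
Proof. by move=> u v; rewrite /iadj adj_sym andbCA. Qed.

Let iadj_irr : irreflexive iadj.
Proof. by move=> u; rewrite /iadj adj_irr !andbF. Qed.

Let iadj_nodes u v : iadj u v -> (nodes G `&` S) u.
Proof.
by case/and3P => /set_mem uS _ /(@adj_nodes G) Gu; split.
Qed.

Definition induced : sgraph :=
  @SGraph (nodes G `&` S) iadj iadj_sym iadj_irr iadj_nodes.

End Induced.

Section Ball.
Variables (H : rooted_graph) (r : nat).

Let ball_nodes : set nat := [set v | within_dist H r (groot H) v].

Let ball_root : nodes (induced H ball_nodes) (groot H).
Proof. by split; [exact: groot_node | exists [::]]. Qed.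

Definition rball : rooted_graph := RootedGraph ball_root.

End Ball.

Definition riso (H1 H2 : rooted_graph) : Prop :=
  exists f : nat -> nat,
    [/\ set_bij (nodes H1) (nodes H2) f,
        f (groot H1) = groot H2 &
        forall u v, nodes H1 u -> nodes H1 v -> adj H2 (f u) (f v) = adj H1 u v].

Section RgraphMeasurable.

Let K1 : sgraph.
Proof. by apply: (@SGraph [set 0%N] (fun _ _ => false)). Defined.

HB.instance Definition _ := gen_eqMixin rooted_graph.
HB.instance Definition _ := gen_choiceMixin rooted_graph.
HB.instance Definition _ :=
  isPointed.Build rooted_graph (@RootedGraph K1 0%N (erefl : [set 0%N] 0%N)).

End RgraphMeasurable.

(* Rooted graphs carry the sigma-algebra generated by the root label and the
   events "v is a node" and "uv is an edge"; for every finite F, the event that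
   F is isomorphic to the r-ball around the root belongs to it. *)
Definition rooted_graph_events : set (set rooted_graph) :=
  [set A | exists u v, [\/ A = [set H | groot H = v],
                           A = [set H | nodes H v] |
                           A = [set H | adj H u v]]].

Notation rooted_graphM := (g_sigma_algebraType rooted_graph_events).

Section Limits.
Variable R : realType.

(* The law U(G), as a set function on rooted graphs; it is a probability when
   the node set of G is finite and nonempty. *)
Definition unif_root (G : sgraph) (A : set rooted_graph) : \bar R :=
  ((#|` fset_set [set v | exists Gv : nodes G v, A (RootedGraph Gv)] |)%:R
   / (#|` fset_set (nodes G) |)%:R)%:E.

Definition ball_prob (r : nat) (F : rooted_graph) (rho : set rooted_graph -> \bar R) : R :=
  fine (rho [set H | riso F (rball H r)]).

Definition has_random_local_limit (d : nat -> measure_display)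
    (Omega : forall n, measurableType (d n))
    (P : forall n, probability (Omega n) R)
    (X : forall n, Omega n -> sgraph)
    (rho : probability rooted_graphM R) : Prop :=
  forall (r : nat) (F : rooted_graph) (eps : R),
    (0 < r)%N -> finite_set (nodes F) -> 0 < eps ->
    (fun n => P n [set w |
       eps < `|ball_prob r F (unif_root (X n w)) - ball_prob r F rho|])
    @ \oo --> 0%E.

Definition labelled_tree (n : nat) (T : sgraph) : Prop :=
  nodes T = [set i | (1 <= i <= n)%N] /\ is_tree T.

Definition Pi_weight (n : nat) (T : sgraph) : R :=
  (\prod_(1 <= i < n.+1) (degree T i)`!)%:R
  / ((n - 2)`! * 'C(3 * n - 3, n - 2))%:R.

Definition random_Pi_tree (n : nat) (d : measure_display)
    (Omega : measurableType d) (P : probability Omega R)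
    (X : Omega -> sgraph) : Prop :=
  (forall w, labelled_tree n (X w)) /\
  (forall T, labelled_tree n T ->
     measurable (X @^-1` [set T]) /\ P (X @^-1` [set T]) = (Pi_weight n T)%:E).

End Limits.

(* Main.v *)
From HB Require Import structures.
Require Import Defs.
From mathcomp Require Import all_boot all_order all_algebra.
From mathcomp Require Import zify lra finmap.
From mathcomp Require Import all_classical all_reals all_analysis.

(** A decorated tree is a tree in which every node orders its neighbours, that
is, a tree given by adjacency lists.  A tree with degrees d_i has prod d_i!
decorations, so Pi_n is the law of the tree underlying a uniformly random
decorated tree, and the normalising constant (n-2)! C(3n-3, n-2) is the number
of decorated trees on n nodes ([decorations_count], [random_tree_law],
[size_dtrees]).

Cut an edge of a decorated tree and keep one side: what remains is a finite
pattern, plus the corner (a node and a position in its list) of the rest of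
the tree at which the pattern hangs.  Conversely, a pattern with k labelled
nodes can be attached at every corner of a decorated tree on the other n - k
nodes, and such a tree has 3(n-k) - 2 corners ([attach_dtree], [handshake]).
As the normalising constants satisfy W_n / W_(n+1) >= (4/27) / (n+1)
([total_weight_step]), a pattern with k nodes occurs at a given node with
probability about 3 (4/27)^k, and two patterns occur at two nodes almost
independently ([occurrences_pair], [pair_bound]).

The patterns in use describe the surroundings of a node v: there is a spine
v = v_0, v_1, ..., v_r, the cut edge leads from v_r to a node v_(r+1) outside,
and the other neighbours of the spine nodes carry finite forests.  The r-ball
around v lies inside such a pattern ([ball_iso]).  In decorated form a forest
is a ternary tree (left forest and right forest of its first tree, remaining
forest), and the weight (4/27)^k makes its law a critical Galton-Watson law:
g = 2/3 + g^3/3 has 1 as its least positive root.  Hence the masses of the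
patterns of spine length r add up to 1 ([forest_mass_upto_near1],
[words_near1]).  Continuing the spine forever, with independent blocks, gives
an infinite tree with one end; its law is the limit.  It is realised on the
unit interval, the blocks being the digits of a real number in a variable
expansion ([limit_law], [limit_ball_prob_bounds]).

It remains to see concentration.  As soon as n exceeds the sum of the sizes
of two patterns, both cannot occur at the same node: the two cut edges would be
different, hence the parts behind them disjoint, and the two patterns would
cover the whole tree ([pattern_unique]).
Fix F, let p be the proportion of nodes whose r-ball is F and rho the limiting
probability.  Take a finite family of patterns of total mass at least 1 - delta
and split it into those whose ball is F and the others, with masses alpha and
beta; let a and b be the proportions of nodes at which they occur.  Then
a <= p, b <= 1 - p and alpha <= rho <= 1 - beta, and lower bounds on the means
of a^2, ab and b^2 by about alpha^2, alpha beta and beta^2 are enough: since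
p^2 = 1 - 2 p (1 - p) - (1 - p)^2 and p = p^2 + p (1 - p), they bound the mean
of (p - rho)^2 from above by 5 delta + O(1/n) ([second_moment]).  Chebyshev's
inequality concludes. *)

Set Implicit Arguments.
Unset Strict Implicit.
Unset Printing Implicit Defensive.

Import Order.TTheory GRing.Theory Num.Theory.
Import numFieldNormedType.Exports.

Local Open Scope classical_set_scope.

(** * Ordered forests in a decorated tree *)

(** A list of subtrees hanging from the same node.  In [Fcons l r s] the root of
the first subtree lists its neighbours as: roots of [l], parent, roots of [r];
the remaining subtrees form [s].  Recording where the parent sits among the
neighbours is what makes forests ternary trees. *)
Inductive forest := Fnil | Fcons of forest & forest & forest.

Fixpoint forest_size (f : forest) : nat :=
  if f is Fcons l r s then (forest_size l + forest_size r + forest_size s).+1 else 0.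

Fixpoint forest_roots (f : forest) (o : nat) : seq nat :=
  if f is Fcons l r s then o :: forest_roots s (o.+1 + forest_size l + forest_size r) else [::].

(** Nodes are numbered from [o] in depth-first order, so that every node has a
larger label than its parent; [p] is the label of the node from which the
forest hangs. *)
Fixpoint forest_nb (f : forest) (p o j : nat) : seq nat :=
  if f is Fcons l r s then
    if j == o then forest_roots l o.+1 ++ p :: forest_roots r (o.+1 + forest_size l)
    else if j < o.+1 + forest_size l then forest_nb l o o.+1 j
    else if j < o.+1 + forest_size l + forest_size r then forest_nb r o (o.+1 + forest_size l) j
    else forest_nb s p (o.+1 + forest_size l + forest_size r) j
  else [::].

Fixpoint forest_par (f : forest) (p o j : nat) : nat :=
  if f is Fcons l r s then
    if j == o then p
    else if j < o.+1 + forest_size l then forest_par l o o.+1 j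
    else if j < o.+1 + forest_size l + forest_size r then forest_par r o (o.+1 + forest_size l) j
    else forest_par s p (o.+1 + forest_size l + forest_size r) j
  else p.

Fixpoint forest_cat (f g : forest) : forest :=
  if f is Fcons l r s then Fcons l r (forest_cat s g) else g.

Lemma forest_size_cat f g : forest_size (forest_cat f g) = forest_size f + forest_size g.
Proof. by elim: f => //= l _ r _ s ->; lia. Qed.

Lemma forest_roots_cat f g o : forest_roots (forest_cat f g) o = forest_roots f o ++ forest_roots g (o + forest_size f).
Proof.
by elim: f o => [|l _ r _ s IHs] o /=; rewrite ?addn0 // IHs; congr (_ :: _ ++ forest_roots _ _); lia.
Qed.

Lemma forest_nb_cat f g p o j : o <= j ->
  forest_nb (forest_cat f g) p o j = if j < o + forest_size f then forest_nb f p o j else forest_nb g p (o + forest_size f) j.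
Proof.
elim: f o => [|l _ r _ s IHs] o oj /=; first by rewrite addn0 ltnNge oj.
case: eqP => [->|_]; first by rewrite -[X in X < _]addn0 ltn_add2l.
case: (ltnP j (o.+1 + forest_size l)) => h1; first by rewrite ifT //; lia.
case: (ltnP j (o.+1 + forest_size l + forest_size r)) => h2; first by rewrite ifT //; lia.
rewrite IHs; last lia.
by rewrite (_ : o.+1 + forest_size l + forest_size r + forest_size s = o + (forest_size l + forest_size r + forest_size s).+1) //; lia.
Qed.

Lemma forest_nb_consl l r s p o j : o < j < o.+1 + forest_size l ->
  forest_nb (Fcons l r s) p o j = forest_nb l o o.+1 j.
Proof. by move=> /andP[h1 h2] /=; rewrite h2 gtn_eqF. Qed.

Lemma forest_nb_consr l r s p o j : o.+1 + forest_size l <= j < o.+1 + forest_size l + forest_size r ->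
  forest_nb (Fcons l r s) p o j = forest_nb r o (o.+1 + forest_size l) j.
Proof.
by move=> /andP[h1 h2] /=; rewrite h2 ltnNge h1 gtn_eqF //; lia.
Qed.

Lemma forest_nb_conss l r s p o j : o.+1 + forest_size l + forest_size r <= j ->
  forest_nb (Fcons l r s) p o j = forest_nb s p (o.+1 + forest_size l + forest_size r) j.
Proof.
move=> h /=; rewrite gtn_eqF; last lia.
by rewrite ltnNge (leq_trans (leq_addr _ _) h) ltnNge h.
Qed.

Lemma forest_par_bound f p o j : p < o -> o <= j < o + forest_size f ->
  (forest_par f p o j == p) || (o <= forest_par f p o j < j).
Proof.
elim: f p o => [|l IHl r IHr s IHs] p o po /= jo; first lia.
case: (eqVneq j o) => [_|jo']; first by rewrite eqxx.
case: (ltnP j (o.+1 + forest_size l)) => h1; first by have := IHl o o.+1 (leqnn _); lia.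
case: (ltnP j (o.+1 + forest_size l + forest_size r)) => h2; first by have := IHr o (o.+1 + forest_size l); lia.
by have := IHs p (o.+1 + forest_size l + forest_size r); lia.
Qed.

Lemma mem_forest_roots f p o k : p < o ->
  (k \in forest_roots f o) = (o <= k < o + forest_size f) && (forest_par f p o k == p).
Proof.
elim: f o => [|l _ r _ s IHs] o po /=; first by rewrite in_nil; lia.
rewrite inE IHs; last lia.
case: eqP => [->|/eqP ko] /=; first by rewrite eqxx andbT; lia.
case: (ltnP k (o.+1 + forest_size l)) => h1.
  case: (boolP (o <= k)) => ok; last by lia.
  by have := @forest_par_bound l o o.+1 k (leqnn _); lia.
case: (ltnP k (o.+1 + forest_size l + forest_size r)) => h2.
  by have := @forest_par_bound r o (o.+1 + forest_size l) k; lia.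
lia.
Qed.

Lemma forest_roots_uniq f o : uniq (forest_roots f o).
Proof.
elim: f o => [|l _ r _ s IHs] o //=; rewrite IHs andbT.
by apply/negP; rewrite (@mem_forest_roots _ o); lia.
Qed.

(** Adjacency is determined by the parent function alone; this is the form in
which symmetry and acyclicity are read off. *)
Lemma mem_forest_nb f p o j k : p < o -> o <= j < o + forest_size f ->
  (k \in forest_nb f p o j) =
  (k == forest_par f p o j) || (o <= k < o + forest_size f) && (forest_par f p o k == j).
Proof.
elim: f p o => [|l IHl r IHr s IHs] p o po /= jo; first lia.
have bl := @forest_par_bound l o o.+1 k (leqnn _).
have br := @forest_par_bound r o (o.+1 + forest_size l) k.
have bs := @forest_par_bound s p (o.+1 + forest_size l + forest_size r) k.
case: (eqVneq j o) => [->|jo'].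
  rewrite mem_cat inE (@mem_forest_roots _ o) // (@mem_forest_roots _ o); last lia.
  by case: (eqVneq k o) => ko; case: (ltnP k (o.+1 + forest_size l)) => h1;
   case: (ltnP k (o.+1 + forest_size l + forest_size r)) => h2 /=; lia.
case: (ltnP j (o.+1 + forest_size l)) => h1.
  rewrite IHl //; last lia.
  have := @forest_par_bound l o o.+1 j (leqnn _).
  by case: (eqVneq k o) => ko; case: (ltnP k (o.+1 + forest_size l)) => h3;
   case: (ltnP k (o.+1 + forest_size l + forest_size r)) => h4 /=; lia.
case: (ltnP j (o.+1 + forest_size l + forest_size r)) => h2.
  rewrite IHr //; last lia; last lia.
  have := @forest_par_bound r o (o.+1 + forest_size l) j.
  by case: (eqVneq k o) => ko; case: (ltnP k (o.+1 + forest_size l)) => h3;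
   case: (ltnP k (o.+1 + forest_size l + forest_size r)) => h4 /=; lia.
rewrite IHs //; last lia; last lia.
have := @forest_par_bound s p (o.+1 + forest_size l + forest_size r) j.
by case: (eqVneq k o) => ko; case: (ltnP k (o.+1 + forest_size l)) => h3;
   case: (ltnP k (o.+1 + forest_size l + forest_size r)) => h4 /=; lia.
Qed.

Lemma forest_nb_uniq f p o j : p < o -> o <= j < o + forest_size f -> uniq (forest_nb f p o j).
Proof.
elim: f p o => [|l IHl r IHr s IHs] p o po /= jo; first lia.
case: (eqVneq j o) => [_|jo'].
  rewrite cat_uniq /= !forest_roots_uniq /= andbT; apply/andP; split; last first.
    by apply/negP; rewrite (@mem_forest_roots _ o); lia.
  apply/negP => /orP[|/hasP[x]]; first by rewrite (@mem_forest_roots _ o); lia.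
  by rewrite !(@mem_forest_roots _ o); lia.
case: (ltnP j (o.+1 + forest_size l)) => h1; first by apply: IHl; lia.
case: (ltnP j (o.+1 + forest_size l + forest_size r)) => h2; first by apply: IHr; lia.
by apply: IHs; lia.
Qed.

Lemma uniq_cat_split (T : eqType) (x : T) s1 s2 t1 t2 :
  uniq (s1 ++ x :: s2) -> s1 ++ x :: s2 = t1 ++ x :: t2 -> s1 = t1 /\ s2 = t2.
Proof.
move=> u e; have u' := u; rewrite e in u'.
have i1 : index x (s1 ++ x :: s2) = size s1.
  rewrite index_cat ifN /=; first by rewrite eqxx addn0.
  by move: u; rewrite cat_uniq /= negb_or; case/and3P => _ /andP[].
have i2 : index x (t1 ++ x :: t2) = size t1.
  rewrite index_cat ifN /=; first by rewrite eqxx addn0.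
  by move: u'; rewrite cat_uniq /= negb_or; case/and3P => _ /andP[].
have sz : size s1 = size t1 by rewrite -i1 e i2.
by move/eqP: e; rewrite eqseq_cat // eqseq_cons eqxx /= => /andP[/eqP-> /eqP->].
Qed.

(** The shape of a forest can be read from a decorated graph: the parent splits
the list of each node into its left and right children, so neither the forest
nor its embedding involves any choice once the roots are known. *)
Lemma forest_determined (T : eqType) (sg : T -> seq T) (phi phi' : nat -> T) :
  (forall x, uniq (sg x)) ->
  forall f f' p p' o o',
    phi p = phi' p' ->
    (forall j, o <= j < o + forest_size f -> sg (phi j) = map phi (forest_nb f p o j)) ->
    (forall j, o' <= j < o' + forest_size f' -> sg (phi' j) = map phi' (forest_nb f' p' o' j)) ->
    map phi (forest_roots f o) = map phi' (forest_roots f' o') ->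
    f = f' /\ forall j, j < forest_size f -> phi (o + j) = phi' (o' + j).
Proof.
move=> U; elim=> [|l IHl r IHr s IHs] [|l' r' s'] // p p' o o' pp e e' /=.
case=> h0 hs.
have eo : sg (phi o) = map phi (forest_roots l o.+1) ++ phi p :: map phi (forest_roots r (o.+1 + forest_size l)).
  by rewrite e /= ?eqxx ?map_cat //; lia.
have eo' : sg (phi o) = map phi' (forest_roots l' o'.+1) ++ phi p :: map phi' (forest_roots r' (o'.+1 + forest_size l')).
  by rewrite h0 e' /= ?eqxx ?map_cat /= ?pp //; lia.
have [|hl hr] := @uniq_cat_split _ _ _ _ _ _ _ (etrans (esym eo) eo'); first by rewrite -eo.
have [j hj|j hj|el pl] := IHl l' o o' o.+1 o'.+1 h0 _ _ hl.
- by rewrite e ?forest_nb_consl //=; lia.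
- by rewrite e' ?forest_nb_consl //=; lia.
have [j hj|j hj|er pr] := IHr r' o o' _ _ h0 _ _ hr.
- by rewrite e ?forest_nb_consr //=; lia.
- by rewrite e' ?forest_nb_consr //=; lia.
have [j hj|j hj|es ps] := IHs s' p p' _ _ pp _ _ hs.
- by rewrite e ?forest_nb_conss //=; lia.
- by rewrite e' ?forest_nb_conss //=; lia.
subst l' r' s'; split=> // -[|j] hj; first by rewrite !addn0.
rewrite !addnS -!addSn.
case: (ltnP j (forest_size l)) => h1; first exact: pl.
have -> : j = forest_size l + (j - forest_size l) by lia.
case: (ltnP (j - forest_size l) (forest_size r)) => h2; first by rewrite !addnA; exact: pr.
have -> : j - forest_size l = forest_size r + (j - forest_size l - forest_size r) by lia.
by rewrite !addnA; apply: ps; lia.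
Qed.

(** * The infinite tree along a spine *)

(** A spine node with its three lists of further neighbours: before, between and
after the two spine neighbours.  The boolean tells whether the previous spine
node precedes the next one in the list. *)
Definition digit : Type := (bool * forest * forest * forest)%type.

Definition digit_forest (d : digit) : forest :=
  let: (_, A, B, C) := d in forest_cat A (forest_cat B C).

Definition digit_size (d : digit) : nat := (forest_size (digit_forest d)).+1.

Section Spine.
Variable D : nat -> digit.

(** Blocks are numbered consecutively, so [off i] is the label of the [i]-th
spine node and a pattern made of the first [m] blocks has the labels below
[off m], which is itself the label of the node outside. *)
Fixpoint off (i : nat) : nat := if i is i'.+1 then off i' + digit_size (D i') else 0.

#[local] Arguments off : simpl never.

Lemma offS i : off i.+1 = off i + digit_size (D i).
Proof. by []. Qed.

Definition blk (j : nat) : nat := find (fun i => j < off i.+1) (iota 0 j.+1).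

Definition hub (i : nat) : seq nat :=
  let: (b, A, B, C) := D i in
  let o := off i in
  let rA := forest_roots A o.+1 in
  let rB := forest_roots B (o.+1 + forest_size A) in
  let rC := forest_roots C (o.+1 + forest_size A + forest_size B) in
  let prev := if i is i'.+1 then [:: off i'] else [::] in
  if b then rA ++ prev ++ rB ++ off i.+1 :: rC
  else rA ++ off i.+1 :: rB ++ prev ++ rC.

Definition nb (j : nat) : seq nat :=
  let i := blk j in
  if j == off i then hub i else forest_nb (digit_forest (D i)) (off i) (off i).+1 j.

Definition par (j : nat) : nat :=
  let i := blk j in
  if j == off i then off i.-1 else forest_par (digit_forest (D i)) (off i) (off i).+1 j.

Lemma off_ltS i : off i < off i.+1.
Proof. by rewrite offS /digit_size; lia. Qed.

Lemma off_mono : {homo off : i j / i < j}.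
Proof. by apply: homo_ltn => [y x z|i]; [exact: ltn_trans | exact: off_ltS]. Qed.

Lemma leq_off : {homo off : i j / i <= j}.
Proof. exact: ltnW_homo off_mono. Qed.

Lemma off_lt i j : (off i < off j) = (i < j).
Proof. by case: (ltngtP i j) => [/off_mono->|/off_mono|->] //; lia. Qed.

Lemma off_inj : injective off.
Proof.
move=> i j e; case: (ltngtP i j) => // /off_mono; by rewrite e ltnn.
Qed.

Lemma off_ge i : i <= off i.
Proof. by elim: i => // i IH; apply: leq_ltn_trans IH (off_ltS i). Qed.

Lemma blkP j : off (blk j) <= j < off (blk j).+1.
Proof.
have h : has (fun i => j < off i.+1) (iota 0 j.+1).
  apply/hasP; exists j; first by rewrite mem_iota; lia.
  exact: leq_ltn_trans (off_ge j) (off_ltS j).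
have := nth_find 0 h; rewrite -/(blk j).
have hs : blk j < j.+1 by move: h; rewrite has_find size_iota.
rewrite nth_iota // add0n => ->; rewrite andbT.
case E : (blk j) => [|i] //.
have hi : i < find (fun i => j < off i.+1) (iota 0 j.+1) by rewrite -/(blk j) E.
have := before_find 0 hi.
by rewrite nth_iota ?add0n; lia.
Qed.

Lemma blkE i j : off i <= j < off i.+1 -> blk j = i.
Proof.
move=> /andP[h1 h2]; have /andP[h3 h4] := blkP j.
case: (ltngtP (blk j) i) => // /leq_off h; lia.
Qed.

Lemma blk_unique i l j : off i <= j < off i.+1 -> off l <= j < off l.+1 -> l = i.
Proof. by move=> /blkE <- /blkE <-. Qed.

Lemma blk_off i : blk (off i) = i.
Proof. by apply: blkE; rewrite leqnn off_ltS. Qed.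

Lemma nb_hub i : nb (off i) = hub i.
Proof. by rewrite /nb blk_off eqxx. Qed.

Lemma off_digit_size i : off i.+1 = (off i).+1 + forest_size (digit_forest (D i)).
Proof. by rewrite offS /digit_size; lia. Qed.

Lemma nb_forest i j : off i < j < off i.+1 ->
  nb j = forest_nb (digit_forest (D i)) (off i) (off i).+1 j.
Proof.
move=> h; have bj : blk j = i by apply: blkE; lia.
by rewrite /nb bj; case: eqP => // ?; lia.
Qed.

Lemma par_off i : par (off i) = off i.-1.
Proof. by rewrite /par blk_off eqxx. Qed.

Lemma par_forest i j : off i < j < off i.+1 ->
  par j = forest_par (digit_forest (D i)) (off i) (off i).+1 j.
Proof.
move=> h; have bj : blk j = i by apply: blkE; lia.
by rewrite /par bj; case: eqP => // ?; lia.
Qed.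

Lemma par_forest_bound i j : off i < j < off i.+1 -> off i <= par j < j.
Proof.
move=> h; rewrite (par_forest h).
have := @forest_par_bound (digit_forest (D i)) (off i) (off i).+1 j (leqnn _).
by move: h; rewrite off_digit_size; lia.
Qed.

Variant block_spec j : Prop :=
  | BlockHub i of j = off i
  | BlockForest i of off i < j < off i.+1.

Lemma blockP j : block_spec j.
Proof.
have /andP[h1 h2] := blkP j; case: (eqVneq j (off (blk j))) => h.
  exact: BlockHub h.
by apply: (@BlockForest _ (blk j)); lia.
Qed.

Lemma par_lt j : 0 < j -> par j < j.
Proof.
case: (blockP j) => [[|i] ->|i /par_forest_bound] //; last lia.
by rewrite par_off => _; apply: off_ltS.
Qed.

(** A parent lies in the same block or is the previous spine node. *)
Lemma par_ge i k : off i < k -> off i <= par k.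
Proof.
case: (blockP k) => [l ->|l hk] h.
  rewrite par_off; apply: leq_off.
  by case: (ltngtP i l) h => [il|/off_mono|->]; lia.
have := par_forest_bound hk.
case: (leqP i l) => [/leq_off|/leq_off]; lia.
Qed.

Lemma mem_hub i k :
  (k \in hub i) = [|| k \in forest_roots (digit_forest (D i)) (off i).+1, k == off i.+1
                   | (0 < i) && (k == off i.-1)].
Proof.
rewrite /hub /digit_forest; case: (D i) => [[[b A] B] C].
rewrite !forest_roots_cat; case: b; case: i => [|i] /=; rewrite !(mem_cat, inE) ?addnA;
case: (k \in forest_roots A _); case: (k \in forest_roots B _); case: (k \in forest_roots C _);
by case: (k == off _); case: (k == off _).
Qed.

Lemma mem_nb j k :
  (k \in nb j) = (0 < j) && (k == par j) || (0 < k) && (par k == j).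
Proof.
case: (blockP j) => i hj.
  rewrite hj nb_hub par_off mem_hub (@mem_forest_roots _ (off i)) //.
  have -> : (0 < off i) = (0 < i).
    by case: i {hj} => // i; rewrite (leq_ltn_trans _ (off_ltS i)).
  rewrite -off_digit_size orbA.
  have -> : [&& off i < k < off i.+1 & forest_par (digit_forest (D i)) (off i) (off i).+1 k == off i]
          || (k == off i.+1) = (0 < k) && (par k == off i).
    case: (blockP k) => [l ->|l hk].
      rewrite par_off (inj_eq off_inj) [off l.-1 == _](inj_eq off_inj).
      have -> : off i < off l < off i.+1 = false.
        by rewrite !off_lt; lia.
      by case: l => [|l] /=; rewrite ?(inj_eq off_inj) ?eqSS /=; [|have := off_ltS l]; lia.
    have /negPf -> : k != off i.+1.
      by apply/eqP => e; have := blk_off i.+1; rewrite -e (@blkE l); [move=> el; move: hk; rewrite e el; lia | lia].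
    rewrite orbF.
    case: (eqVneq l i) => [el|il].
      by rewrite -el hk (par_forest hk) /=; lia.
    have -> : off i < k < off i.+1 = false.
      by apply/negP => h; move/eqP: il; apply; apply: (@blk_unique _ _ k); lia.
    apply/esym/negP => /andP[_ /eqP e]; have := par_forest_bound hk; rewrite e => h.
    move/eqP: il; apply; apply: (@blk_unique _ _ (off i)); have := off_ltS i; lia.
  by rewrite orbC.
have jgt : 0 < j by lia.
rewrite (nb_forest hj) mem_forest_nb //; last by rewrite -off_digit_size.
rewrite -(par_forest hj) jgt -off_digit_size; congr (_ || _).
case: (blockP k) => [l ->|l hk].
  rewrite par_off; transitivity false.
    apply/negP => /andP[h _]; have : l = i by rewrite -(blk_off l); apply: blkE; lia.
    by move=> e; rewrite e ltnn in h.
  apply/esym/negP => /andP[_ /eqP e]; move: hj; rewrite -e => h.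
  have : l.-1 = i by rewrite -(blk_off l.-1); apply: blkE; lia.
  by move=> e'; move: h; rewrite e' ltnn.
case: (eqVneq l i) => [el|il].
  by rewrite -el hk (par_forest hk) /=; lia.
have -> : off i < k < off i.+1 = false.
  by apply/negP => h; move/eqP: il; apply; apply: (@blk_unique _ _ k); lia.
apply/esym/negP => /andP[_ /eqP e]; have := par_forest_bound hk; rewrite e => h.
move/eqP: il; apply; apply: (@blk_unique _ _ j); lia.
Qed.

Lemma nb_sym j k : (k \in nb j) = (j \in nb k).
Proof. by rewrite !mem_nb orbC [j == _]eq_sym [k == _]eq_sym. Qed.

Lemma nb_irr j : j \notin nb j.
Proof.
rewrite mem_nb; case: (posnP j) => [->|/par_lt]; rewrite ?ltnn //=; lia.
Qed.

Lemma nb_lt j k : k < j -> k \in nb j -> k = par j.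
Proof.
by move=> kj; rewrite mem_nb => /orP[/andP[_ /eqP]//|/andP[k0 /eqP e]]; have := par_lt k0; lia.
Qed.

Lemma nb_par j : 0 < j -> par j \in nb j.
Proof. by move=> j0; rewrite mem_nb j0 eqxx. Qed.

(** The only exit from the first [i] blocks is the next spine node. *)
Lemma nb_le i j k : j < off i -> k \in nb j -> k <= off i.
Proof.
move=> ji; rewrite mem_nb => /orP[/andP[j0 /eqP->]|/andP[k0 /eqP e]].
  have := par_lt j0; lia.
by case: (leqP k (off i)) => // /par_ge; rewrite e; lia.
Qed.

Lemma nb_next i j : j < off i.+1 -> (off i.+1 \in nb j) = (j == off i).
Proof.
move=> h; rewrite mem_nb par_off /= [off i == _]eq_sym.
have -> : 0 < off i.+1 by exact: leq_ltn_trans (off_ltS i).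
case: (posnP j) => [->|/par_lt h'] //=; case: eqP => [e|]//; lia.
Qed.

Lemma uniq_cat_lt m (s t : seq nat) :
  all (fun x => x < m) s -> all (fun x => m <= x) t -> uniq s -> uniq t -> uniq (s ++ t).
Proof.
move=> /allP hs /allP ht us ut; rewrite cat_uniq us ut andbT.
by apply/hasPn => x /ht mx; apply/negP => /hs; rewrite ltnNge mx.
Qed.

(** Up to reordering the list is increasing: previous spine node, the three
groups of roots, next spine node. *)
Lemma hub_uniq i : uniq (hub i).
Proof.
set prev := if i is i'.+1 then [:: off i'] else [::].
case E : (D i) => [[[b A] B] C].
set o := (off i).+1.
have nx : off i.+1 = o + forest_size A + forest_size B + forest_size C.
  by rewrite off_digit_size E /= !forest_size_cat !addnA.
pose s := prev ++ forest_roots A o ++ forest_roots B (o + forest_size A) ++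
          forest_roots C (o + forest_size A + forest_size B) ++ [:: off i.+1].
have /perm_uniq -> : perm_eq (hub i) s.
  rewrite /hub E; apply/permP => a.
  by rewrite /s; case: b {E}; rewrite -/prev -/o !count_cat /= ?count_cat /=; lia.
have geR f m : off i < m -> all (fun x => m <= x) (forest_roots f m).
  by move=> h; apply/allP => x; rewrite (@mem_forest_roots _ (off i)) // => /andP[/andP[]].
have ltR f m : off i < m -> all (fun x => x < m + forest_size f) (forest_roots f m).
  by move=> h; apply/allP => x; rewrite (@mem_forest_roots _ (off i)) // => /andP[/andP[]].
have weak m n l : m <= n -> all (fun x => n <= x) l -> all (fun x => m <= x) l.
  by move=> mn /allP h; apply/allP => x /h; apply: leq_trans.
have oA : off i < o + forest_size A by rewrite ltn_addr.
have oB : off i < o + forest_size A + forest_size B by rewrite ltn_addr.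
apply: (@uniq_cat_lt (off i)) => //; last 1 first.
- apply: (@uniq_cat_lt (o + forest_size A)); rewrite ?ltR ?forest_roots_uniq //.
    rewrite !all_cat geR //= (weak _ _ _ (leq_addr _ _) (geR _ _ oB)) nx; lia.
  apply: (@uniq_cat_lt (o + forest_size A + forest_size B)); rewrite ?ltR ?forest_roots_uniq //.
    rewrite all_cat geR //= nx; lia.
  by apply: (@uniq_cat_lt (off i.+1)); rewrite ?forest_roots_uniq //= ?leqnn // nx ltR.
- rewrite /prev; case: (i) => // i'; by rewrite /= off_ltS.
- rewrite !all_cat /= (weak _ _ _ (leqnSn _) (geR _ _ (leqnn _))).
  by rewrite (weak _ _ _ (ltnW oA) (geR _ _ oA)) (weak _ _ _ (ltnW oB) (geR _ _ oB)) ltnW ?off_ltS.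
- by rewrite /prev; case: (i).
Qed.

Lemma nb_uniq j : uniq (nb j).
Proof.
case: (blockP j) => i hj; first by rewrite hj nb_hub hub_uniq.
by rewrite (nb_forest hj); apply: forest_nb_uniq; rewrite // -off_digit_size.
Qed.

End Spine.

Arguments off : simpl never.

Lemma eq_off m D D' : (forall i, i < m -> D i = D' i) ->
  forall i, i <= m -> off D i = off D' i.
Proof.
by move=> e; elim=> //= i IH im; rewrite !offS IH ?e //; lia.
Qed.

Lemma eq_nb m D D' : (forall i, i < m -> D i = D' i) ->
  forall j, j < off D m -> nb D j = nb D' j.
Proof.
move=> e j jm; have eo := eq_off e.
have bm : blk D j < m.
  by rewrite ltnNge; apply/negP => /(leq_off D); have := blkP D j; lia.
have o1 : off D (blk D j) = off D' (blk D j) by apply: eo; apply: ltnW.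
have o2 : off D (blk D j).+1 = off D' (blk D j).+1 by apply: eo.
have bE : blk D' j = blk D j by apply: blkE; rewrite -o1 -o2 blkP.
rewrite /nb bE -o1 -(e _ bm); case: eqP => // _.
rewrite /hub -o1 -o2 -(e _ bm).
by move: bm {bE o1 o2}; case: (blk D j) => // i im; rewrite (eo _ (ltnW (ltnW im))).
Qed.

(** The first spine node has no predecessor, and its two lists are encoded by the
outer components. *)
Definition valid_first (d : digit) : bool :=
  let: (b, _, B, _) := d in b && (if B is Fnil then true else false).

Section Determined.
Variables (T : eqType) (sg : T -> seq T).
Hypothesis sg_uniq : forall x, uniq (sg x).

(** * Reading a pattern back from a decorated graph *)

(** Two marked entries cut a duplicate-free list into three in only one way, and
their order is part of the list. *)
Lemma hub_lists_determined (x y : T) s1 s2 s3 t1 t2 t3 (b b' : bool) l :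
  uniq l ->
  l = (if b then s1 ++ x :: s2 ++ y :: s3 else s1 ++ y :: s2 ++ x :: s3) ->
  l = (if b' then t1 ++ x :: t2 ++ y :: t3 else t1 ++ y :: t2 ++ x :: t3) ->
  [/\ b = b', s1 = t1, s2 = t2 & s3 = t3].
Proof.
have swap (u v : T) r1 r2 r3 q1 q2 q3 : uniq (r1 ++ u :: r2 ++ v :: r3) ->
    r1 ++ u :: r2 ++ v :: r3 = q1 ++ v :: q2 ++ u :: q3 -> False.
  have -> : r1 ++ u :: r2 ++ v :: r3 = (r1 ++ u :: r2) ++ v :: r3 by rewrite -catA.
  move=> U e; have [h _] := uniq_cat_split U e.
  by move: U; rewrite e -h cat_uniq => /and3P[_ /hasPn/(_ u)];
     rewrite !(mem_cat, inE) eqxx !orbT => /(_ isT).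
have same (u v : T) r1 r2 r3 q1 q2 q3 : uniq (r1 ++ u :: r2 ++ v :: r3) ->
    r1 ++ u :: r2 ++ v :: r3 = q1 ++ u :: q2 ++ v :: q3 -> [/\ r1 = q1, r2 = q2 & r3 = q3].
  move=> U e; have [h1 h2] := uniq_cat_split U e.
  have U2 : uniq (r2 ++ v :: r3) by move: U; rewrite cat_uniq /= => /and4P[].
  by have [h3 h4] := uniq_cat_split U2 h2.
move=> U e1 e2; have := U; rewrite e1; rewrite e1 in e2.
case: b e2 {e1}; case: b' => e2 U1.
- by have [-> -> ->] := same _ _ _ _ _ _ _ _ U1 e2.
- by case: (swap _ _ _ _ _ _ _ _ U1 e2).
- by case: (swap _ _ _ _ _ _ _ _ U1 e2).
- by have [-> -> ->] := same _ _ _ _ _ _ _ _ U1 e2.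
Qed.

Lemma three_forests_determined (phi phi' : nat -> T) A B C A' B' C' p p' o o' :
  phi p = phi' p' ->
  (forall j, o <= j < o + forest_size (forest_cat A (forest_cat B C)) ->
     sg (phi j) = map phi (forest_nb (forest_cat A (forest_cat B C)) p o j)) ->
  (forall j, o' <= j < o' + forest_size (forest_cat A' (forest_cat B' C')) ->
     sg (phi' j) = map phi' (forest_nb (forest_cat A' (forest_cat B' C')) p' o' j)) ->
  map phi (forest_roots A o) = map phi' (forest_roots A' o') ->
  map phi (forest_roots B (o + forest_size A)) = map phi' (forest_roots B' (o' + forest_size A')) ->
  map phi (forest_roots C (o + forest_size A + forest_size B)) = map phi' (forest_roots C' (o' + forest_size A' + forest_size B')) ->
  [/\ A = A', B = B', C = C' &
      forall j, j < forest_size (forest_cat A (forest_cat B C)) -> phi (o + j) = phi' (o' + j)].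
Proof.
move=> pp; rewrite !forest_size_cat => h h' eA eB eC.
have fA f E D j q r : r <= j < r + forest_size E ->
    forest_nb (forest_cat E (forest_cat f D)) q r j = forest_nb E q r j.
  by case/andP=> h1 h2; rewrite forest_nb_cat // h2.
have fB f E D j q r : r + forest_size E <= j < r + forest_size E + forest_size f ->
    forest_nb (forest_cat E (forest_cat f D)) q r j = forest_nb f q (r + forest_size E) j.
  case/andP=> h1 h2; rewrite forest_nb_cat; last lia.
  by rewrite ltnNge h1 /= forest_nb_cat // h2.
have fC f E D j q r : r + forest_size E + forest_size f <= j ->
    forest_nb (forest_cat E (forest_cat f D)) q r j = forest_nb D q (r + forest_size E + forest_size f) j.
  move=> h1; rewrite forest_nb_cat; last lia.
  rewrite ifN; last lia.
  by rewrite forest_nb_cat; [rewrite ifN //; lia | lia].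
have [j hj|j hj|EA pA] := @forest_determined _ sg phi phi' sg_uniq _ _ _ _ _ _ pp _ _ eA.
- by rewrite h ?fA //; lia.
- by rewrite h' ?fA //; lia.
have [j hj|j hj|EB pB] := @forest_determined _ sg phi phi' sg_uniq _ _ _ _ _ _ pp _ _ eB.
- by rewrite h ?fB //; lia.
- by rewrite h' ?fB //; lia.
have [j hj|j hj|EC pC] := @forest_determined _ sg phi phi' sg_uniq _ _ _ _ _ _ pp _ _ eC.
- by rewrite h ?fC //; lia.
- by rewrite h' ?fC //; lia.
subst A' B' C'; split=> // j hj.
case: (ltnP j (forest_size A)) => h1; first exact: pA.
have -> : j = forest_size A + (j - forest_size A) by lia.
case: (ltnP (j - forest_size A) (forest_size B)) => h2; first by rewrite !addnA; exact: pB.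
have -> : j - forest_size A = forest_size B + (j - forest_size A - forest_size B) by lia.
by rewrite !addnA; apply: pC; lia.
Qed.

Variables (D D' : nat -> digit) (m : nat) (phi phi' : nat -> T).
Hypotheses (v0 : valid_first (D 0)) (v0' : valid_first (D' 0)).
Hypothesis h : forall j, j < off D m -> sg (phi j) = map phi (nb D j).
Hypothesis h' : forall j, j < off D' m -> sg (phi' j) = map phi' (nb D' j).
Hypothesis hspine : forall i, i <= m -> phi (off D i) = phi' (off D' i).

Lemma block_determined i : i < m ->
  D i = D' i /\ forall j, j < digit_size (D i) -> phi (off D i + j) = phi' (off D' i + j).
Proof.
move=> im; have oi := hspine (ltnW im).
have om : off D i.+1 <= off D m by exact: leq_off.
have om' : off D' i.+1 <= off D' m by exact: leq_off.
have e : sg (phi (off D i)) = map phi (hub D i).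
  by rewrite h ?nb_hub //; have := off_ltS D i; lia.
have e' : sg (phi (off D i)) = map phi' (hub D' i).
  by rewrite oi h' ?nb_hub //; have := off_ltS D' i; lia.
have f j : (off D i).+1 <= j < (off D i).+1 + forest_size (digit_forest (D i)) ->
    sg (phi j) = map phi (forest_nb (digit_forest (D i)) (off D i) (off D i).+1 j).
  by rewrite -off_digit_size => hj; rewrite h ?(nb_forest hj) //; lia.
have f' j : (off D' i).+1 <= j < (off D' i).+1 + forest_size (digit_forest (D' i)) ->
    sg (phi' j) = map phi' (forest_nb (digit_forest (D' i)) (off D' i) (off D' i).+1 j).
  by rewrite -off_digit_size => hj; rewrite h' ?(nb_forest hj) //; lia.
have U := sg_uniq (phi (off D i)).
suff : [/\ D i = D' i & forall j, j < forest_size (digit_forest (D i)) ->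
    phi ((off D i).+1 + j) = phi' ((off D' i).+1 + j)].
  case=> -> k; split=> // -[|j] hj; first by rewrite !addn0.
  by rewrite !addnS -!addSn k.
move: e e' f f'; rewrite /hub /digit_forest.
case E : (D i) => [[[b A] B] C]; case E' : (D' i) => [[[b' A'] B'] C'].
have nx := hspine im.
move=> e e' f f'.
have [eb eA eB eC] : [/\ b = b',
   map phi (forest_roots A (off D i).+1) = map phi' (forest_roots A' (off D' i).+1),
   map phi (forest_roots B ((off D i).+1 + forest_size A)) = map phi' (forest_roots B' ((off D' i).+1 + forest_size A')) &
   map phi (forest_roots C ((off D i).+1 + forest_size A + forest_size B)) =
   map phi' (forest_roots C' ((off D' i).+1 + forest_size A' + forest_size B'))].
  case: i im {f f' om om'} oi E E' nx e e' U => [|i] im oi E E' nx e e' U.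
    move: v0 v0' e e'; rewrite E E' /valid_first.
    case: b {E} => //; case: B => //; case: b' {E'} => //; case: B' => //= _ _ e e'.
    rewrite !map_cat /= nx in e e'; rewrite e in U.
    by have [-> ->] := uniq_cat_split U (etrans (esym e) e').
  have pv := hspine (ltnW (ltnW im)).
  apply: (@hub_lists_determined (phi (off D i)) (phi (off D i.+2)) _ _ _ _ _ _ b b' _ U).
    by rewrite e; case: (b); rewrite !map_cat /= ?map_cat.
  by rewrite e' pv nx; case: (b'); rewrite !map_cat /= ?map_cat.
have [EA EB EC k] := three_forests_determined oi f f' eA eB eC.
by rewrite eb EA EB EC in k *.
Qed.

(** Once the spine is known, every block is: its two spine neighbours cut the
list of a spine node into three lists of roots. *)
Lemma pattern_determined :
  (forall i, i < m -> D i = D' i) /\ (forall j, j <= off D m -> phi j = phi' j).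
Proof.
have eD i : i < m -> D i = D' i by move=> /block_determined[].
split=> // j jm.
have eo := eq_off eD.
case: (eqVneq j (off D m)) => [->|jne]; first by rewrite hspine // eo.
have bm : blk D j < m.
  by rewrite ltnNge; apply/negP => /(leq_off D); have := blkP D j; lia.
have [_] := block_determined bm; move=> /(_ (j - off D (blk D j))).
have /andP[h1 h2] := blkP D j; rewrite -eo; last lia.
by rewrite subnKC //; apply; move: h2; rewrite offS; lia.
Qed.

End Determined.

(** * Balls in decorated graphs *)
Section DecoratedGraph.
Variables (A : set nat) (sg : nat -> seq nat).

Let gadj : rel nat := fun u v =>
  [&& u \in A, v \in A, u != v, v \in sg u & u \in sg v].

Let gadj_sym : symmetric gadj.
Proof.
by move=> u v; rewrite /gadj eq_sym; case: (u \in A); case: (v \in A); case: (v == u);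
   case: (u \in sg v); case: (v \in sg u).
Qed.

Let gadj_irr : irreflexive gadj.
Proof. by move=> u; rewrite /gadj eqxx !andbF. Qed.

Let gadj_nodes u v : gadj u v -> A u.
Proof. by case/and5P => /set_mem. Qed.

Definition decorated_graph : sgraph := SGraph gadj_sym gadj_irr gadj_nodes.

End DecoratedGraph.

Lemma decorated_adjE A sg u v : adj (decorated_graph A sg) u v =
  [&& u \in A, v \in A, u != v, v \in sg u & u \in sg v].
Proof. by []. Qed.

Definition limit_graph (D : nat -> digit) : rooted_graph :=
  @RootedGraph (decorated_graph setT (nb D)) 0 I.

Arguments limit_graph : simpl never.

Lemma limit_adjE D u v : adj (limit_graph D) u v = (v \in nb D u).
Proof.
rewrite [LHS]decorated_adjE !in_setT /= [u \in _]nb_sym andbb; case: eqP => //= ->.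
by rewrite (negPf (nb_irr _ _)).
Qed.

Lemma sgraph_eq G H : nodes G = nodes H -> adj G =2 adj H -> G = H.
Proof.
case: G H => [V e s i n] [V' e' s' i' n'] /= eV ee.
have ee' : e = e' by apply/funext => x; apply/funext => y.
by subst V' e'; congr SGraph; apply: Prop_irrelevance.
Qed.

Lemma riso_trans H1 H2 H3 : riso H1 H2 -> riso H2 H3 -> riso H1 H3.
Proof.
move=> [f [fb fr fa]] [g [gb gr ga]]; exists (g \o f); split.
- exact: set_bij_comp fb gb.
- by rewrite /= fr gr.
- move=> u v u1 v1 /=; have [fun_f _ _] := fb.
  by rewrite ga ?fa //; exact: fun_f.
Qed.

Lemma riso_sym H1 H2 : riso H1 H2 -> riso H2 H1.
Proof.
move=> [f [[ff fi fs] fr fa]].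
have /choice[g hg] : forall y, exists x, nodes H2 y -> nodes H1 x /\ f x = y.
  move=> y; case: (pselect (nodes H2 y)) => [/fs[x x1 xy]|ny]; last by exists 0.
  by exists x.
have gK x : nodes H1 x -> g (f x) = x.
  move=> x1; have [|y1 y2] := hg (f x); first exact: ff.
  by apply: fi => //; exact: mem_set.
exists g; split.
- split.
  + by move=> y y2; have [] := hg y y2.
  + move=> y z /set_mem y2 /set_mem z2 e.
    by have [_ <-] := hg y y2; have [_ <-] := hg z z2; rewrite e.
  + by move=> x x1; exists (f x); [exact: ff | exact: gK].
- by rewrite -fr gK //; exact: groot_node.
- move=> u v u2 v2; have [u1 uE] := hg u u2; have [v1 vE] := hg v v2.
  by rewrite -fa // uE vE.
Qed.

Lemma path_cons (T : Type) (e : rel T) x y p :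
  path e x (y :: p) = e x y && path e y p.
Proof. by []. Qed.

Lemma rball_adjE H r u v : adj (rball H r) u v =
  [&& u \in [set x | within_dist H r (groot H) x],
      v \in [set x | within_dist H r (groot H) x] & adj H u v].
Proof. by []. Qed.

Section BallIso.
Variables (D : nat -> digit) (r : nat) (H : rooted_graph) (phi : nat -> nat).
Let M := off D r.+1.
Hypothesis phi_inj : forall j k, j <= M -> k <= M -> phi j = phi k -> j = k.
Hypothesis phi0 : phi 0 = groot H.
Hypothesis phi_nb : forall j x, j < M -> adj H (phi j) x = (x \in map phi (nb D j)).

Let nb_phi j k : j < M -> k <= M -> adj H (phi j) (phi k) = (k \in nb D j).
Proof.
move=> jM kM; rewrite phi_nb //; apply/mapP/idP => [[l lj e]|kj]; last by exists k.
by rewrite (phi_inj kM _ e) //; apply: nb_le lj.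
Qed.

Let pathG i j p : i + size p <= r.+1 -> j < off D i ->
  path (adj (limit_graph D)) j p ->
  last j p < off D (i + size p) /\ path (adj H) (phi j) (map phi p) .
Proof.
elim: p i j => [|k p IH] i j; first by rewrite addn0.
rewrite map_cons [size _]/= [last j _]/= !path_cons addnS => ir ji /andP[jk kp]; rewrite limit_adjE in jk.
have ki : k < off D i.+1 by apply: leq_ltn_trans (off_ltS D i); apply: nb_le jk.
have [] := IH i.+1 k; rewrite ?addSn //; last first.
move=> h1 h2; split=> //; rewrite h2 andbT nb_phi //.
  by apply: leq_trans ji (leq_off _ _); lia.
by apply: leq_trans (ltnW ki) (leq_off _ _); lia.
Qed.

Let pathH i j q : i + size q <= r.+1 -> j < off D i ->
  path (adj H) (phi j) q ->
  exists2 p, path (adj (limit_graph D)) j p & q = map phi p.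
Proof.
elim: q i j => [|x q IH] i j; first by exists [::].
rewrite path_cons [size _]/= addnS => ir ji /andP[jx xq].
have jM : j < M by apply: leq_trans ji (leq_off _ _); lia.
move: jx; rewrite phi_nb // => /mapP[k kj xk].
have ki : k < off D i.+1 by apply: leq_ltn_trans (off_ltS D i); apply: nb_le kj.
rewrite xk in xq; have [|p kp ->] := IH i.+1 k _ ki xq; first lia.
by exists (k :: p); rewrite ?xk // path_cons kp limit_adjE kj.
Qed.

Let path_nodes (G : sgraph) u p : nodes G u -> path (adj G) u p -> nodes G (last u p).
Proof.
elim: p u => //= v p IH u _ /andP[uv]; apply: IH.
by apply: (@adj_nodes G v u); rewrite adj_sym.
Qed.

(** A walk of length [i] from the root stays within the first [i + 1] blocks, on
which [phi] preserves neighbourhoods; this holds as well for walks in [H],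
which therefore lift along [phi]. *)
Lemma ball_iso : riso (rball (limit_graph D) r) (rball H r).
Proof.
have o1 : 0 < off D 1 by exact: (off_ltS D 0).
have ballM j : within_dist (limit_graph D) r 0 j -> j < M.
  case=> p [p0 <- pr]; have [|+ _] := pathG (i := 1) (j := 0) (p := p) _ o1 p0; first lia.
  by move=> h; apply: leq_trans h (leq_off _ _); lia.
exists phi; split.
- split.
  + move=> _ [_ [p [p0 <- pr]]].
    have [|_] := pathG (i := 1) (j := 0) (p := p) _ o1 p0; first lia.
    rewrite phi0 -last_map phi0 => h; split.
      by apply: path_nodes h; exact: groot_node.
    by exists (map phi p); rewrite size_map.
  + move=> j k /set_mem[_ /ballM jM] /set_mem[_ /ballM kM]; apply: phi_inj; exact: ltnW.
  + move=> x [_ [q [q0 <- qr]]].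
    rewrite -phi0 in q0 *; have [|p p0 e] := pathH (i := 1) (j := 0) (q := q) _ o1 q0; first lia.
    rewrite {q q0}e in qr *.
    exists (last 0 p); last by rewrite last_map.
    by split=> //; exists p; split=> //; rewrite size_map in qr.
- exact: phi0.
- move=> u v [_ ub] [_ vb]; have uM := ballM _ ub; have vM := ballM _ vb.
  have inb j : within_dist (limit_graph D) r 0 j -> within_dist H r (groot H) (phi j).
    case=> p [p0 <- pr].
    have [|_] := pathG (i := 1) (j := 0) (p := p) _ o1 p0; first lia.
    by move=> h; exists (map phi p); rewrite size_map -phi0 last_map.
  rewrite !rball_adjE !mem_set //; [|exact: inb..].
  by rewrite (nb_phi uM (ltnW vM)) -limit_adjE.
Qed.

End BallIso.

(** The ball of radius [r] does not see beyond block [r]; this makes the events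
of the limit law depend on finitely many digits. *)
Lemma limit_ball_prefix D D' r F : (forall i, i <= r -> D i = D' i) ->
  riso F (rball (limit_graph D) r) -> riso F (rball (limit_graph D') r).
Proof.
move=> e h; apply: riso_trans h _; apply: (@ball_iso D r (limit_graph D') id) => //.
move=> j x jM; rewrite map_id limit_adjE (@eq_nb r.+1 D D') // => i; rewrite ltnS; exact: e.
Qed.

Lemma seq_argmax (T : eqType) (h : T -> nat) (s : seq T) x : x \in s ->
  exists2 y, y \in s & forall z, z \in s -> h z <= h y.
Proof.
elim: s x => // a [|b s] IH x xs.
  by exists a; rewrite ?mem_head // => z; rewrite inE => /eqP ->.
have [y ys hy] := IH b (mem_head _ _).
case: (leqP (h y) (h a)) => hya.
  exists a; rewrite ?mem_head // => z; rewrite inE => /orP[/eqP->//|/hy]; lia.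
exists y; first by rewrite in_cons ys orbT.
by move=> z; rewrite in_cons => /orP[/eqP->|/hy//]; lia.
Qed.

(** Orient the nodes of [S] by letting each have at most one neighbour that is
not strictly higher.  On a cycle the highest node of [S] would have two. *)
Lemma ucycle_avoids (e : rel nat) (S : pred nat) (h : nat -> nat) (c : seq nat) :
  symmetric e ->
  (forall y a b, S y -> e y a -> e y b -> ~~ (S a && (h y < h a)) ->
     ~~ (S b && (h y < h b)) -> a = b) ->
  2 < size c -> ucycle e c -> forall x, x \in c -> ~~ S x.
Proof.
move=> esym one sc /andP[cc cu] x xc; apply/negP => Sx.
have [|y] := @seq_argmax _ h [seq z <- c | S z] x; first by rewrite mem_filter Sx.
rewrite mem_filter => /andP[Sy yc] ymax.
have notup z : z \in c -> ~~ (S z && (h y < h z)).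
  move=> zc; apply/negP => /andP[Sz]; rewrite ltnNge ymax // mem_filter Sz.
  exact: zc.
have [i p hp] := rot_to yc.
have sp : 1 < size p by have := size_rot i c; rewrite hp /=; lia.
have : cycle e (rot i c) by rewrite rot_cycle.
have : uniq (rot i c) by rewrite rot_uniq.
have pc z : z \in p -> z \in c by move=> zp; rewrite -(mem_rot i) hp inE zp orbT.
rewrite hp; case/lastP: p sp {hp} pc => [|[|a p] b] //= _ pc.
rewrite rcons_path /= last_rcons => /andP[_ /andP[+ _]] /andP[ya /andP[_]].
rewrite mem_rcons inE negb_or => /andP[ab _]; rewrite esym => yb.
move/eqP: ab; apply; apply: (one y) => //; apply: notup; apply: pc.
  by rewrite mem_head.
by rewrite inE mem_rcons mem_head orbT.
Qed.

(** * Decorated trees *)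
Definition nrel (sg : nat -> seq nat) : rel nat := fun x y => y \in sg x.

Definition joined (sg : nat -> seq nat) (x y : nat) : Prop :=
  exists2 p, path (nrel sg) x p & last x p = y.

Lemma joined_trans sg x y z : joined sg x y -> joined sg y z -> joined sg x z.
Proof.
move=> [p p1 p2] [q q1 q2]; exists (p ++ q); first by rewrite cat_path p1 p2.
by rewrite last_cat p2.
Qed.

Lemma joined_edge sg x y : y \in sg x -> joined sg x y.
Proof. by move=> h; exists [:: y]; rewrite //= andbT. Qed.

Lemma joined_refl sg x : joined sg x x.
Proof. by exists [::]. Qed.

Lemma joined_sym sg x y : (forall x y, (y \in sg x) = (x \in sg y)) ->
  joined sg x y -> joined sg y x.
Proof.
move=> s [p p1 <-]; exists (rev (belast x p)).
  by rewrite rev_path; rewrite (eq_path (e' := nrel sg)) // => a b; rewrite /nrel s.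
by case: p {p1} => //= a p; rewrite rev_cons last_rcons.
Qed.

Lemma limit_graph_tree D : infinite_rooted_tree (limit_graph D).
Proof.
have adjE : adj (limit_graph D) =2 nrel (nb D) by exact: limit_adjE.
split; first exact: infinite_nat.
split; first by exists 0.
- have toroot u : joined (nb D) u 0.
    elim/ltn_ind: u => u IH; case: (posnP u) => [->|u0]; first exact: joined_refl.
    by apply: joined_trans (IH _ (par_lt D u0)); apply: joined_edge; rewrite nb_par.
  move=> u v _ _; have [p p1 p2] : joined (nb D) u v.
    by apply: joined_trans (toroot u) _; apply: joined_sym (toroot v) => x y; rewrite nb_sym.
  by exists p => //; rewrite (eq_path adjE).
- move=> c sc cc; have [x xc] : exists x, x \in c.
    by case: c sc {cc} => // x c _; exists x; rewrite mem_head.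
  suff : ~~ predT x by [].
  (* the largest label on a cycle would have two smaller neighbours *)
  apply: (@ucycle_avoids (adj (limit_graph D)) predT id c _ _ sc cc) => //.
    exact: adj_sym.
  move=> y a b _; rewrite !limit_adjE /= -!leqNgt => ya yb ay by_.
  have ne z : z \in nb D y -> z != y by apply: contraTneq => ->; apply: nb_irr.
  by rewrite (nb_lt _ ya) 1?(nb_lt _ yb) // ltn_neqAle ?ay ?by_ ?ne.
Qed.

Record dtree (V : seq nat) (sg : nat -> seq nat) : Prop := DTree {
  dt_out : forall x, x \notin V -> sg x = [::];
  dt_uniq : forall x, uniq (sg x);
  dt_sym : forall x y, (y \in sg x) = (x \in sg y);
  dt_irr : forall x, x \notin sg x;
  dt_conn : forall x y, x \in V -> y \in V -> joined sg x y;
  dt_acyc : forall c, 2 < size c -> ~ ucycle (nrel sg) c }.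

Lemma dt_in V sg x y : dtree V sg -> y \in sg x -> x \in V.
Proof. by move=> T; apply: contraTT => /(dt_out T) ->. Qed.

Lemma dt_in2 V sg x y : dtree V sg -> y \in sg x -> y \in V.
Proof. by move=> T; rewrite (dt_sym T); apply: dt_in. Qed.

Lemma dtree_adj V sg x y : dtree V sg ->
  adj (decorated_graph [set` V] sg) x y = (y \in sg x).
Proof.
move=> T; rewrite decorated_adjE -(dt_sym T x y) andbb.
case yx: (y \in sg x); last by rewrite !andbF.
rewrite !mem_setE (dt_in T yx) (dt_in2 T yx) /= andbT.
by apply: contraTneq yx => ->; apply: dt_irr T _.
Qed.

Lemma dtree_is_tree V sg : V != [::] -> dtree V sg -> is_tree (decorated_graph [set` V] sg).
Proof.
move=> V0 T; have e := dtree_adj _ _ T.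
split.
- by case: V V0 {T e} => // x V _; exists x; rewrite /= mem_head.
- move=> u v uV vV; have [p p1 p2] := dt_conn T uV vV; exists p => //.
  by rewrite (eq_path e).
- by move=> c sc; rewrite /ucycle (eq_cycle e); apply: dt_acyc T _ sc.
Qed.

Lemma is_tree_dtree V sg :
  (forall x, x \notin V -> sg x = [::]) -> (forall x, uniq (sg x)) ->
  (forall x y, adj (decorated_graph [set` V] sg) x y = (y \in sg x)) ->
  is_tree (decorated_graph [set` V] sg) -> dtree V sg.
Proof.
move=> h1 h2 e [_ h3 h4]; split => //.
- by move=> x y; rewrite -!e adj_sym.
- by move=> x; rewrite -e adj_irr.
- by move=> x y xV yV; have [p p1 p2] := h3 x y xV yV; exists p; rewrite // -(eq_path e).
- by move=> c sc; rewrite /ucycle -(eq_cycle e); apply: h4.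
Qed.

Lemma dtree_eq_mem V V' sg : V =i V' -> dtree V sg -> dtree V' sg.
Proof.
move=> e [h1 h2 h3 h4 h5 h6]; split=> // [x|x y]; first by rewrite -e; apply: h1.
by rewrite -!e; apply: h5.
Qed.

Lemma joined_closed sg (U : pred nat) x y :
  (forall a b, U a -> b \in sg a -> U b) -> U x -> joined sg x y -> U y.
Proof.
move=> cl + [p + <-]; elim: p x => //= b p IH x Ux /andP[xb]; apply: IH.
exact: cl Ux xb.
Qed.

(** A connected graph on [n] nodes has at least [n - 1] edges: away from a root,
each node has a neighbour that is closer to the root. *)
Lemma handshake V sg : uniq V -> dtree V sg ->
  2 * (size V).-1 <= \sum_(x <- V) size (sg x).
Proof.
case: V => [|v V] U T; first by rewrite muln0.
have walk x : x \in v :: V ->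
    exists n, `[< exists p, [/\ path (nrel sg) v p, last v p = x & size p = n] >].
  move=> xV; have [p p1 p2] := dt_conn T (mem_head v V) xV.
  by exists (size p); apply/asboolP; exists p.
pose dist x := if pselect (x \in v :: V) is left h then ex_minn (walk x h) else 0.
have prP x : exists y, x \in V -> y \in sg x /\ dist y < dist x.
  case: (boolP (x \in V)) => xV; last by exists 0.
  have xV' : x \in v :: V by rewrite inE xV orbT.
  have nxv : x != v by apply: contraTneq xV => ->; case/andP: U.
  rewrite {2}/dist; case: pselect => // h; case: ex_minnP => n /asboolP[p [p1 p2 p3]] nmin.
  case/lastP: p p1 p2 p3 => [_ /= e|p z]; first by rewrite e eqxx in nxv.
  rewrite rcons_path last_rcons size_rcons => /andP[p1 zx] e p3; subst z.
  exists (last v p) => _; rewrite (dt_sym T); split => //.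
  rewrite /dist; case: pselect => [h'|nh].
    case: ex_minnP => k _ kmin; rewrite -p3 ltnS; apply: kmin.
    by apply/asboolP; exists p.
  by rewrite -p3.
have [pr hpr] := choice prP.
have UV : uniq V by case/andP: U.
pose L := [seq (x, pr x) | x <- V] ++ [seq (pr x, x) | x <- V].
have UL : uniq L.
  rewrite cat_uniq; apply/and3P; split.
  - by rewrite map_inj_uniq // => x y [].
  - apply/hasPn => _ /mapP[y yV ->]; apply/negP => /mapP[x xV [e1 e2]].
    have [_ ] := hpr x xV; have [_ ] := hpr y yV; rewrite -e2 e1 => h1 h2.
    by have := ltn_trans h1 h2; rewrite ltnn.
  - by rewrite map_inj_uniq // => x y [].
have sub : {subset L <= [seq (x, y) | x <- v :: V, y <- sg x]}.
  move=> [x y]; rewrite mem_cat => /orP[] /mapP[z zV [-> ->]]; apply/allpairsPdep.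
    by exists z, (pr z); rewrite inE zV orbT; have [-> _] := hpr z zV.
  exists (pr z), z; have [h _] := hpr z zV; split=> //.
    exact: dt_in2 T h.
  by rewrite (dt_sym T).
have := uniq_leq_size UL sub.
by rewrite size_cat !size_map size_allpairs_dep sumnE big_map mul2n addnn.
Qed.

(** * Patterns in decorated trees *)

(** The label [M] is that of the node outside: its image is constrained to be new,
but nothing is said of its neighbours. *)
Definition embeds (sg : nat -> seq nat) (D : nat -> digit) (M : nat) (phi : nat -> nat) : Prop :=
  [/\ forall j k, j <= M -> k <= M -> phi j = phi k -> j = k &
      forall j, j < M -> sg (phi j) = map phi (nb D j)].

Section PatternUnique.
Variables (V : seq nat) (sg : nat -> seq nat) (m : nat).
Hypothesis T : dtree V sg.
Hypothesis m_gt0 : 0 < m.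

(** If the second pattern does not contain the outer node of the first one, then
the spine of the first must leave the second pattern.  It does so in [m] steps,
and the only walk of [m] steps out of a pattern of [m] blocks is its spine. *)
Lemma spine_walk D D' phi phi' :
  embeds sg D (off D m) phi -> embeds sg D' (off D' m) phi' -> phi 0 = phi' 0 ->
  (forall k, k < off D' m -> phi' k != phi (off D m)) ->
  forall i, i <= m -> phi (off D i) = phi' (off D' i).
Proof.
move=> [inj e] [inj' e'] e0 out.
have offm i : i < m -> off D i < off D m by rewrite off_lt.
have nxt i : i < m -> phi (off D i.+1) \in sg (phi (off D i)).
  move=> im; rewrite e ?offm // map_f // nb_next ?eqxx //; exact: off_ltS.
have fwd i : i <= m -> exists2 k, phi (off D i) = phi' k & k <= off D' i.
  elim: i => [|i IH] im; first by exists 0.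
  have [k kE ki] := IH (ltnW im).
  have kM : k < off D' m by apply: leq_ltn_trans ki _; rewrite off_lt.
  have := nxt i im; rewrite kE e' // => /mapP[k' k'k ->]; exists k' => //.
  apply: nb_le k'k; exact: leq_ltn_trans ki (off_ltS _ _).
have last : phi (off D m) = phi' (off D' m).
  have [k kE] := fwd m (leqnn _); rewrite leq_eqVlt => /orP[/eqP <- //|/out].
  by rewrite kE eqxx.
have bwd i : i <= m -> phi (off D (m - i)) = phi' (off D' (m - i)).
  elim: i => [|i IH] im; first by rewrite subn0.
  have hi : m - i = (m - i.+1).+1 by lia.
  set l := m - i.+1 in hi *; have lm : l < m by rewrite /l; lia.
  have eS := IH (ltnW im); rewrite hi in eS.
  have [k kE kl] := fwd l (ltnW lm).
  have kS : k < off D' l.+1 := leq_ltn_trans kl (off_ltS _ _).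
  have kM : k < off D' m by apply: leq_trans kS (leq_off _ lm).
  have := nxt l lm; rewrite eS kE e' // => /mapP[k' k'k eq].
  have k'M : k' <= off D' m := nb_le kM k'k.
  move: k'k; rewrite -(inj' _ _ (leq_off D' lm) k'M eq) nb_next // => /eqP ->.
  by [].
by move=> i im; rewrite -(subKn im); apply: bwd; lia.
Qed.

(** If each pattern contained the outer node of the other, their union would be
closed under adjacency, hence the whole tree, against the bound on the sizes.
Otherwise the spines agree, and then so does everything. *)
Lemma pattern_unique D D' phi phi' : uniq V ->
  valid_first (D 0) -> valid_first (D' 0) ->
  embeds sg D (off D m) phi -> embeds sg D' (off D' m) phi' -> phi 0 = phi' 0 ->
  off D m + off D' m < size V ->
  (forall i, i < m -> D i = D' i) /\ (forall j, j <= off D m -> phi j = phi' j).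
Proof.
move=> UV v0 v0' E E' e0 big.
apply: (@pattern_determined _ sg (dt_uniq T)) => //; [by case: E|by case: E'|].
case: (boolP (has (fun k => phi' k == phi (off D m)) (iota 0 (off D' m)))) => [/hasP[k]|/hasPn h]; last first.
  apply: spine_walk => // k kM; apply: h; by rewrite mem_iota.
rewrite mem_iota /= add0n => kM /eqP ke.
case: (boolP (has (fun k => phi k == phi' (off D' m)) (iota 0 (off D m)))) => [/hasP[l]|/hasPn h]; last first.
  move=> i im; apply/esym; apply: spine_walk => // j jM; apply: h; by rewrite mem_iota.
rewrite mem_iota /= add0n => lM /eqP le; exfalso.
case: E E' => [inj e] [inj' e'].
pose U := [seq phi j | j <- iota 0 (off D m)] ++ [seq phi' j | j <- iota 0 (off D' m)].
have inU j : j < off D m -> phi j \in U.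
  by move=> jM; rewrite mem_cat map_f // mem_iota.
have inU' j : j < off D' m -> phi' j \in U.
  by move=> jM; rewrite mem_cat map_f ?orbT // mem_iota.
have cl a b : a \in U -> b \in sg a -> b \in U.
  rewrite mem_cat => /orP[] /mapP[j]; rewrite mem_iota /= add0n => jM ->.
    rewrite e // => /mapP[k' k'j ->]; have := nb_le jM k'j.
    by rewrite leq_eqVlt => /orP[/eqP ->|/inU//]; rewrite -ke; apply: inU'.
  rewrite e' // => /mapP[k' k'j ->]; have := nb_le jM k'j.
  by rewrite leq_eqVlt => /orP[/eqP ->|/inU'//]; rewrite -le; apply: inU.
have o1 : 0 < off D m := leq_trans m_gt0 (off_ge D m).
have v0V : phi 0 \in V.
  have h : off D 1 \in nb D (off D 0) by rewrite (nb_next (off_ltS D 0)).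
  by apply: (@dt_in _ _ _ (phi (off D 1)) T); rewrite e // map_f.
have sub : {subset V <= U}.
  move=> x xV; apply: (joined_closed cl) (dt_conn T v0V xV); exact: inU.
by have := uniq_leq_size UV sub; rewrite size_cat !size_map !size_iota leqNgt big.
Qed.

End PatternUnique.

(** * Attaching a pattern at a corner *)
Definition insert_at (T : Type) (i : nat) (x : T) (s : seq T) : seq T :=
  take i s ++ x :: drop i s.

Lemma perm_insert_at (T : eqType) i (x : T) s : perm_eq (insert_at i x s) (x :: s).
Proof. by rewrite /insert_at perm_catC /= perm_cons perm_catC cat_take_drop. Qed.

Lemma insert_at_rem (T : eqType) i (x : T) s : x \notin s -> rem x (insert_at i x s) = s.
Proof.
move=> xs; rewrite /insert_at -[RHS](cat_take_drop i s).
have : x \notin take i s by apply: contra xs => /mem_take.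
elim: (take i s) => /= [_|y t IH]; first by rewrite eqxx.
by rewrite inE negb_or [x == y]eq_sym => /andP[/negPf -> /IH ->].
Qed.

Lemma insert_at_index (T : eqType) i (x : T) s : x \notin s -> i <= size s ->
  index x (insert_at i x s) = i.
Proof.
move=> xs is_; rewrite /insert_at index_cat ifN /= ?eqxx ?addn0 ?size_takel //.
by apply: contra xs => /mem_take.
Qed.

Section Attach.
Variables (V : seq nat) (sg : nat -> seq nat) (D : nat -> digit) (m : nat).
Variables (zs : seq nat) (u i : nat).
Let M := off D m.
Let phi := nth u zs.
Let top := phi (off D m.-1).

(** The pattern is placed on the labels [zs] and hung from position [i] of the
node [u].  As [u] is the default value of [nth], the outer label [M], which is
the size of [zs], is sent to [u]. *)
Definition attach : nat -> seq nat := fun x =>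
  if x \in zs then map phi (nb D (index x zs))
  else if x == u then insert_at i top (sg u) else sg x.

Definition detach (zs : seq nat) (top : nat) (sg : nat -> seq nat) : nat -> seq nat :=
  fun x => if x \in zs then [::] else rem top (sg x).

Hypothesis T : dtree V sg.
Hypothesis m_gt0 : 0 < m.
Hypothesis zsM : size zs = M.
Hypothesis zsU : uniq zs.
Hypothesis zsV : forall x, x \in zs -> x \notin V.
Hypothesis uV : u \in V.

Let top_lt : off D m.-1 < M.
Proof. by rewrite /M off_lt; lia. Qed.

Let uz : u \notin zs.
Proof. by apply/negP => /zsV; rewrite uV. Qed.

Let phiM : phi M = u.
Proof. by rewrite /phi nth_default // zsM. Qed.

Let phi_in j : j < M -> phi j \in zs.
Proof. by move=> jM; rewrite mem_nth // zsM. Qed.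

Lemma phi_inj j k : j <= M -> k <= M -> phi j = phi k -> j = k.
Proof.
rewrite leq_eqVlt => /orP[/eqP->|jM]; rewrite leq_eqVlt => /orP[/eqP->|kM] //.
- by rewrite phiM => e; have := phi_in kM; rewrite -e (negPf uz).
- by rewrite phiM => e; have := phi_in jM; rewrite e (negPf uz).
- by move/eqP; rewrite nth_uniq ?zsM // => /eqP.
Qed.

Let zsP x : x \in zs -> exists2 j, j < M & x = phi j.
Proof.
by move=> xz; exists (index x zs); [rewrite -zsM index_mem | rewrite /phi nth_index].
Qed.

Lemma attach_phi j : j < M -> attach (phi j) = map phi (nb D j).
Proof. by move=> jM; rewrite /attach phi_in // index_uniq // zsM. Qed.

Lemma attach_embeds : embeds attach D M phi.
Proof. by split; [exact: phi_inj | exact: attach_phi]. Qed.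

Lemma attach_out x : x \notin zs -> x != u -> attach x = sg x.
Proof. by rewrite /attach => /negPf -> /negPf ->. Qed.

Let top_out x : top \notin sg x.
Proof. by apply/negP => /(dt_in2 T); apply/negP; rewrite zsV // phi_in. Qed.

Lemma mem_attach_pp j k : j < M -> k <= M -> (phi k \in attach (phi j)) = (k \in nb D j).
Proof.
move=> jM kM; rewrite attach_phi //; apply/mapP/idP => [[l lj e]|kj]; last by exists k.
by rewrite (phi_inj kM _ e) //; apply: nb_le lj.
Qed.

Lemma mem_attach_pv j y : j < M -> y \notin zs ->
  (y \in attach (phi j)) = (y == u) && (j == off D m.-1).
Proof.
move=> jM yz.
have nx : (M \in nb D j) = (j == off D m.-1).
  by rewrite -(@nb_next D m.-1 j) prednK.
case: (eqVneq y u) => [->|yu] /=; first by rewrite -phiM mem_attach_pp.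
rewrite attach_phi //; apply/mapP => -[k kj e].
have := nb_le jM kj; rewrite leq_eqVlt => /orP[/eqP kM|kM].
  by move: yu; rewrite e kM phiM eqxx.
by move: yz; rewrite e phi_in.
Qed.

Lemma mem_attach_vv x y : x \notin zs -> y \notin zs -> (y \in attach x) = (y \in sg x).
Proof.
move=> xz yz; rewrite /attach (negPf xz); case: eqP => // ->.
rewrite (perm_mem (perm_insert_at _ _ _)) inE; case: eqP => // ytop.
by move: yz; rewrite ytop phi_in.
Qed.

Lemma mem_attach_vp x k : x \notin zs -> k < M ->
  (phi k \in attach x) = (x == u) && (k == off D m.-1).
Proof.
move=> xz kM; have nsg z : phi k \notin sg z.
  by apply/negP => /(dt_in2 T); apply/negP; rewrite zsV // phi_in.
rewrite /attach (negPf xz); case: eqP => [_|_] /=; last by rewrite (negPf (nsg _)).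
rewrite (perm_mem (perm_insert_at _ _ _)) inE (negPf (nsg _)) orbF.
by rewrite nth_uniq ?zsM.
Qed.

Let attach_sym x y : (y \in attach x) = (x \in attach y).
Proof.
case: (boolP (x \in zs)) => xz; case: (boolP (y \in zs)) => yz.
- have [j jM ->] := zsP xz; have [k kM ->] := zsP yz.
  by rewrite !mem_attach_pp ?(ltnW jM) ?(ltnW kM) // nb_sym.
- by have [j jM ->] := zsP xz; rewrite mem_attach_pv // mem_attach_vp.
- by have [k kM ->] := zsP yz; rewrite mem_attach_pv // mem_attach_vp.
- by rewrite !mem_attach_vv // (dt_sym T).
Qed.

(* Decreasing towards [u]: along the spine the block number increases, inside a
   block labels decrease towards the spine. *)
Let rank j := (m - blk D j) * M + j.
Let up j := if j == off D (blk D j) then off D (blk D j).+1 else par D j.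

Let blk_lt j : j < M -> blk D j < m.
Proof.
move=> jM; rewrite ltnNge; apply/negP => /(leq_off D); have /andP[] := blkP D j.
rewrite -/M; lia.
Qed.

Let rank_lt_blk j k : j < M -> blk D k < blk D j -> rank j < rank k.
Proof.
move=> jM bl; have bj := blk_lt jM.
rewrite /rank (_ : m - blk D k = (m - blk D j) + (blk D j - blk D k)); last lia.
have : M <= (blk D j - blk D k) * M by apply: leq_pmull; lia.
by rewrite mulnDl; lia.
Qed.

Let upE j k : j < M -> k \in nb D j -> ~~ ((k < M) && (rank j < rank k)) -> k = up j.
Proof.
move=> jM kj low; have bj := blk_lt jM.
have /andP[b1 b2] := blkP D j.
have kle := nb_le b2 kj.
have nextM : off D (blk D j).+1 <= M by exact: leq_off.
have nj : k != j by apply: contraTneq kj => ->; apply: nb_irr.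
have high : j < k -> k < off D (blk D j).+1 -> False.
  move=> jk kb; case/negP: low; rewrite (leq_trans kb nextM) /rank.
  by rewrite (@blkE D (blk D j) k) ?kb ?ltn_add2l ?jk //; lia.
rewrite /up; case: eqP => [e|ne].
  case: (ltngtP k j) nj => // [kj' _|jk _].
    case/negP: low; rewrite (ltn_trans kj' jM) /=; apply: rank_lt_blk => //.
    rewrite ltnNge; apply/negP => /(leq_off D) h; have /andP[] := blkP D k; lia.
  by move: kle; rewrite leq_eqVlt => /orP[/eqP //|/(high jk)].
case: (ltngtP k j) nj => // [kj' _|jk _]; first exact: nb_lt kj.
move: kle; rewrite leq_eqVlt => /orP[/eqP kE|/(high jk) //].
by move: kj; rewrite kE nb_next // => /eqP.
Qed.

(** A cycle cannot use the nodes of the pattern, each of which has a single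
neighbour that is closer to [u]; it would then be a cycle of the old tree. *)
Lemma attach_dtree : dtree (zs ++ V) attach.
Proof.
have asym := attach_sym.
split => //.
- move=> x; rewrite mem_cat negb_or => /andP[xz xV].
  rewrite attach_out // ?(dt_out T) //; by apply: contraNneq xV => ->.
- move=> x; case: (boolP (x \in zs)) => xz.
    have [j jM ->] := zsP xz; rewrite attach_phi // map_inj_in_uniq ?nb_uniq //.
    by move=> a b aj bj; apply: phi_inj; [exact: nb_le aj | exact: nb_le bj].
  rewrite /attach (negPf xz); case: eqP => [_|_]; last exact: dt_uniq T _.
  by rewrite (perm_uniq (perm_insert_at _ _ _)) /= top_out (dt_uniq T).
- move=> x; case: (boolP (x \in zs)) => xz; last by rewrite mem_attach_vv // (dt_irr T).
  by have [j jM ->] := zsP xz; rewrite mem_attach_pp ?(ltnW jM) // nb_irr.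
- have VV x y : x \in V -> y \in V -> joined attach x y.
    move=> xV yV; have [p p1 p2] := dt_conn T xV yV; exists p => //.
    apply: sub_path p1 => a b /= ab; rewrite /nrel mem_attach_vv //.
      by apply/negP => /zsV; rewrite (dt_in T ab).
    by apply/negP => /zsV; rewrite (dt_in2 T ab).
  have to0 j : j <= M -> joined attach (phi j) (phi 0).
    elim/ltn_ind: j => j IH jM; case: (posnP j) => [->|j0]; first exact: joined_refl.
    have pj := par_lt D j0.
    apply: joined_trans (IH _ pj _); last lia.
    by apply: joined_edge; rewrite asym mem_attach_pp //; [rewrite nb_sym nb_par | lia].
  have tou x : x \in zs ++ V -> joined attach x u.
    rewrite mem_cat => /orP[/zsP[j jM ->]|xV]; last exact: VV.
    apply: joined_trans (to0 _ (ltnW jM)) _; apply: joined_sym asym _.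
    by rewrite -phiM; apply: to0.
  by move=> x y /tou xu /tou yu; apply: joined_trans xu _; apply: joined_sym asym _.
- move=> c sc cc.
  have avoid : forall x, x \in c -> x \notin zs.
    apply: (@ucycle_avoids (nrel attach) (fun x => x \in zs) (fun x => rank (index x zs)) c _ _ sc cc).
      by move=> x y; rewrite /nrel asym.
    move=> y a b /zsP[j jM ->].
    have one z : nrel attach (phi j) z ->
        ~~ ((z \in zs) && (rank (index (phi j) zs) < rank (index z zs))) -> z = phi (up j).
      rewrite /nrel attach_phi // => /mapP[k kj ->] low; congr phi; apply: upE => //.
      move: low; rewrite index_uniq ?zsM //.
      have := nb_le jM kj; rewrite leq_eqVlt => /orP[/eqP ->|kM]; first by rewrite ltnn.
      by rewrite phi_in // index_uniq ?zsM // kM.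
    by move=> ya yb /(one _ ya) -> /(one _ yb) ->.
  apply: (dt_acyc T sc); case/andP: cc => c1 c2; rewrite /ucycle c2 andbT.
  apply: (sub_in_cycle (P := [pred x | x \notin zs])) c1; last by apply/allP => x /avoid.
  by move=> x y xz yz; rewrite /nrel mem_attach_vv.
Qed.

Lemma detach_attach : detach zs top attach = sg.
Proof.
apply/funext => x; rewrite /detach /attach; case: (boolP (x \in zs)) => xz.
  by rewrite (dt_out T) // zsV.
case: eqP => [->|_]; first by rewrite insert_at_rem // top_out.
by rewrite rem_id // top_out.
Qed.

Lemma attach_index : i <= size (sg u) -> index top (attach u) = i.
Proof. by move=> iu; rewrite /attach (negPf uz) eqxx insert_at_index // top_out. Qed.

End Attach.

(** * Counting decorated trees *)
Definition adjacency : choiceType := (nat -> seq nat).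

Definition upd (sg : adjacency) (x : nat) (s : seq nat) : adjacency :=
  fun y => if y == x then s else sg y.

Fixpoint fun_enum (V : seq nat) (C : nat -> seq (seq nat)) : seq adjacency :=
  if V is x :: V' then [seq upd sg x s | s <- C x, sg <- fun_enum V' C]
  else [:: (fun=> [::]) : adjacency].

Lemma mem_fun_enum V C (sg : adjacency) : uniq V ->
  reflect ((forall x, x \in V -> sg x \in C x) /\ (forall x, x \notin V -> sg x = [::]))
          (sg \in fun_enum V C).
Proof.
elim: V sg => [|x V IH] sg /=.
  move=> _; rewrite inE; apply: (iffP eqP) => [-> //|[_ h]].
  by apply/funext => y; apply: h.
move=> /andP[xV UV]; apply: (iffP allpairsP) => [[[s sg'] /= [sC /(IH _ UV)[h1 h2] ->]]|[h1 h2]].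
  split=> y; rewrite inE /upd; case: eqP => [->|_] //=; [exact: h1 | exact: h2].
exists (sg x, upd sg x [::]); split => /=.
- by apply: h1; rewrite mem_head.
- apply/(IH _ UV); split=> y yV; rewrite /upd; case: eqP => [yx|yx] //.
  + by move: xV; rewrite -yx yV.
  + by apply: h1; rewrite inE yV orbT.
  + by apply: h2; rewrite inE negb_or yV andbT; apply/eqP.
- by apply/funext => y; rewrite /upd; case: eqP => // ->.
Qed.

Lemma fun_enum_uniq V C : uniq V -> (forall x, uniq (C x)) -> uniq (fun_enum V C).
Proof.
move=> + UC; elim: V => //= x V IH /andP[xV UV].
apply: allpairs_uniq => //; first exact: IH.
move=> [s sg] [t tau] /allpairsP[[a b] /= [_ hb [-> ->]]] /allpairsP[[c d] /= [_ hd [-> ->]]] e.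
have /(mem_fun_enum _ _ UV)[_ b0] := hb; have /(mem_fun_enum _ _ UV)[_ d0] := hd.
congr pair; first by have := congr1 (@^~ x) e; rewrite /upd eqxx.
apply/funext => y; case: (eqVneq y x) => [->|yx]; first by rewrite b0 ?d0.
by have := congr1 (@^~ y) e; rewrite /upd (negPf yx).
Qed.

Lemma size_fun_enum V C : size (fun_enum V C) = \prod_(x <- V) size (C x).
Proof.
by elim: V => [|x V IH] /=; rewrite ?big_nil // big_cons size_allpairs IH.
Qed.

Fixpoint all_seqs (V : seq nat) (n : nat) : seq (seq nat) :=
  if n is n'.+1 then [::] :: [seq x :: s | x <- V, s <- all_seqs V n'] else [:: [::]].

Lemma mem_all_seqs V n s : all (fun x => x \in V) s -> size s <= n -> s \in all_seqs V n.
Proof.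
elim: n s => [|n IH] [|x s] //= /andP[xV sV] sn.
by rewrite inE /=; apply/allpairsP; exists (x, s); split=> //=; apply: IH.
Qed.

Definition dtrees (V : seq nat) : seq adjacency :=
  [seq sg <- fun_enum V (fun=> undup (all_seqs V (size V))) | `[< dtree V sg >]].

Lemma mem_dtrees V sg : uniq V -> (sg \in dtrees V) = `[< dtree V sg >].
Proof.
move=> UV; rewrite mem_filter andb_idr // => /asboolP T.
apply/mem_fun_enum => //; split=> [x xV|]; last exact: dt_out T.
have sub : {subset sg x <= V} by move=> y; apply: dt_in2 T.
rewrite mem_undup mem_all_seqs //; first by apply/allP.
by apply: uniq_leq_size => //; exact: dt_uniq T _.
Qed.

Lemma dtrees_uniq V : uniq V -> uniq (dtrees V).
Proof.
by move=> UV; apply: filter_uniq; apply: fun_enum_uniq => // x; apply: undup_uniq.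
Qed.

Lemma leq_size_inj (S T : eqType) (f : S -> T) (s : seq S) (t : seq T) :
  uniq s -> {in s &, injective f} -> (forall x, x \in s -> f x \in t) -> size s <= size t.
Proof.
move=> us fi st; rewrite -(size_map f); apply: uniq_leq_size.
  by rewrite map_inj_in_uniq.
by move=> _ /mapP[x xs ->]; apply: st.
Qed.

Section Relabel.
Variables (V V' : seq nat).
Hypotheses (UV : uniq V) (UV' : uniq V') (sVV : size V = size V').
Let g x := nth 0 V' (index x V).
Let g' x := nth 0 V (index x V').

Let gK : {in V, cancel g g'}.
Proof.
move=> x xV; rewrite /g' /g index_uniq ?nth_index // -sVV index_mem //.
Qed.

Let gV x : x \in V -> g x \in V'.
Proof. by move=> xV; rewrite mem_nth // -sVV index_mem. Qed.

Let gV' x : x \in V' -> g' x \in V.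
Proof. by move=> xV; rewrite mem_nth // sVV index_mem. Qed.

Let gK' x : x \in V' -> g (g' x) = x.
Proof. by move=> xV; rewrite /g' /g index_uniq ?nth_index // sVV index_mem. Qed.

Let g_inj : {in V &, injective g}.
Proof. by move=> x y xV yV e; rewrite -(gK xV) e gK. Qed.

Let relabel (sg : adjacency) : adjacency :=
  fun y => if y \in V' then map g (sg (g' y)) else [::].

Let relabel_mem sg x y : dtree V sg -> x \in V -> y \in V ->
  (g y \in relabel sg (g x)) = (y \in sg x).
Proof.
move=> T xV yV; rewrite /relabel gV // gK //; apply/mapP/idP => [[z zx e]|yx]; last by exists y.
by rewrite (g_inj yV _ e) //; apply: dt_in2 T zx.
Qed.

Let relabel_dtree sg : dtree V sg -> dtree V' (relabel sg).
Proof.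
move=> T.
have inV' x y : y \in relabel sg x -> (x \in V') && (y \in V').
  rewrite /relabel; case: ifP => // xV /mapP[z zx ->] /=; apply: gV.
  exact: dt_in2 T zx.
have mem x y : x \in V' -> y \in V' -> (y \in relabel sg x) = (g' y \in sg (g' x)).
  by move=> xV yV; rewrite -(relabel_mem T (gV' xV) (gV' yV)) !gK'.
split.
- by move=> x /negPf xV; rewrite /relabel xV.
- move=> x; rewrite /relabel; case: ifP => // xV.
  rewrite map_inj_in_uniq ?(dt_uniq T) // => a b /(dt_in2 T) aV /(dt_in2 T) bV.
  exact: g_inj.
- move=> x y; apply/idP/idP => h; have /andP[h1 h2] := inV' _ _ h.
    by rewrite mem // -(dt_sym T) -mem.
  by rewrite mem // (dt_sym T) -mem.
- move=> x; apply/negP => h; have /andP[h1 h2] := inV' _ _ h.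
  by move: h; rewrite mem // (negPf (dt_irr T _)).
- move=> x y xV yV; have [p p1 p2] := dt_conn T (gV' xV) (gV' yV).
  exists (map g p); last by rewrite -[x]gK' // last_map p2 gK'.
  have g'x := gV' xV; rewrite -[x]gK' //; move: (g' x) g'x p1 {p2}.
  elim: p => //= b p IH a aV /andP[ab bp]; rewrite IH //; last exact: dt_in2 T ab.
  by rewrite andbT /nrel relabel_mem //; exact: dt_in2 T ab.
- move=> c sc /andP[c1 c2]; apply: (@dt_acyc _ _ T (map g' c)); first by rewrite size_map.
  have cV : {subset c <= V'}.
    move=> x xc; have := next_cycle c1 xc.
    by move=> /inV'/andP[].
  apply/andP; split; last first.
    rewrite map_inj_in_uniq // => x y /cV xV /cV yV e.
    by rewrite -(gK' xV) e gK'.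
  rewrite cycle_map; apply: (sub_in_cycle (P := [pred x | x \in V'])) c1.
    by move=> x y xV yV; rewrite /nrel /= mem.
  by apply/allP => x /cV.
Qed.

(** The number of decorated trees depends only on the number of labels; one
inequality suffices, as the two sets play symmetric roles. *)
Lemma leq_dtrees : size (dtrees V) <= size (dtrees V').
Proof.
apply: (@leq_size_inj _ _ relabel); first exact: dtrees_uniq.
- move=> sg tau; rewrite !mem_dtrees // => /asboolP T /asboolP T' e.
  apply/funext => x; case: (boolP (x \in V)) => xV; last by rewrite (dt_out T) ?(dt_out T').
  have := congr1 (@^~ (g x)) e; rewrite /relabel gV // gK //.
  by apply: (inj_in_map g_inj); apply/allP => a; [apply: dt_in2 T|apply: dt_in2 T'].
- by move=> sg; rewrite !mem_dtrees // => /asboolP T; apply/asboolP; apply: relabel_dtree.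
Qed.

End Relabel.

Fixpoint inj_seqs (k : nat) (s : seq nat) : seq (seq nat) :=
  if k is k'.+1 then [seq x :: t | x <- s, t <- inj_seqs k' (rem x s)] else [:: [::]].

Lemma size_inj_seqs k s : size (inj_seqs k s) = size s ^_ k.
Proof.
elim: k s => [|k IH] s /=; first by rewrite ffactn0.
rewrite size_allpairs_dep sumnE big_map ffactnS big_seq.
under eq_bigr => x xs do rewrite IH size_rem //.
by rewrite -big_seq big_const_seq count_predT iter_addn_0 mulnC.
Qed.

Lemma mem_inj_seqs k s z : uniq s -> z \in inj_seqs k s ->
  [/\ uniq z, {subset z <= s} & size z = k].
Proof.
elim: k s z => [|k IH] s z us /=; first by rewrite inE => /eqP ->.
move=> /allpairsPdep[x [t [xs tk ->]]].
have [ut ts st] := IH _ _ (rem_uniq x us) tk; split => /=; last by rewrite st.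
  by rewrite ut andbT; apply/negP => /ts; rewrite mem_rem_uniq // inE eqxx.
by move=> y; rewrite inE => /orP[/eqP -> //|/ts /mem_rem].
Qed.

Lemma inj_seqs_uniq k s : uniq s -> uniq (inj_seqs k s).
Proof.
elim: k s => [|k IH] s us //=; apply: allpairs_uniq_dep => //.
  by move=> x xs; apply: IH; apply: rem_uniq.
by move=> [x t] [y u] _ _ /= [-> ->].
Qed.

(** The place of attachment is visible in the result: the node outside is the
parent of the top of the pattern, and the top occupies the position [i]. *)
Lemma attach_inj V sg tau D m zs u i s k :
  dtree V sg -> dtree V tau -> 0 < m -> size zs = off D m -> uniq zs ->
  (forall x, x \in zs -> x \notin V) -> u \in V -> s \in V ->
  i <= size (sg u) -> k <= size (tau s) ->
  attach sg D m zs u i = attach tau D m zs s k -> [/\ sg = tau, u = s & i = k].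
Proof.
move=> T T' m0 zM zU zV uV sV iu ks e.
have [_ E] := attach_embeds sg i zM zU zV uV.
have [_ E'] := attach_embeds tau k zM zU zV sV.
have tl : off D m.-1 < off D m by rewrite off_lt; lia.
have topE x y : nth x zs (off D m.-1) = nth y zs (off D m.-1).
  by apply: set_nth_default; rewrite zM.
have us : u = s.
  have := E _ tl; rewrite e (topE u s) (E' _ tl) => /eq_in_map/(_ (off D m)).
  rewrite -{1}(prednK m0) nb_next ?prednK // eqxx => /(_ isT).
  by rewrite !nth_default ?zM.
subst s; split=> //.
  have := detach_attach i T m0 zM zU zV uV; rewrite e => <-.
  by rewrite (detach_attach k T' m0 zM zU zV sV).
by have := attach_index T m0 zM zU zV uV iu; rewrite e (attach_index T' m0 zM zU zV uV ks).
Qed.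

Definition digit0 : digit := (true, Fnil, Fnil, Fnil).
Definition digits_of (w : seq digit) : nat -> digit := nth digit0 w.
Definition pattern_size (w : seq digit) : nat := off (digits_of w) (size w).

Definition occurs (sg : nat -> seq nat) (w : seq digit) (v : nat) : Prop :=
  exists2 phi, phi 0 = v & embeds sg (digits_of w) (pattern_size w) phi.

Definition occurrences (sg : adjacency) (n : nat) (w : seq digit) : nat :=
  count (fun v => `[< occurs sg w v >]) (iota 1 n).

(** As opposed to [occurs], the images of all nodes of the pattern are prescribed,
in order. *)
Definition occurs_on (sg : nat -> seq nat) (w : seq digit) (z : seq nat) : Prop :=
  exists2 phi, map phi (iota 0 (pattern_size w)) = z & embeds sg (digits_of w) (pattern_size w) phi.

(** A node with [k] neighbours has [k + 1] corners. *)
Definition corners (V : seq nat) (sg : nat -> seq nat) : seq (nat * nat) :=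
  [seq (u, i) | u <- V, i <- iota 0 (size (sg u)).+1].

Lemma mem_corners V sg c : (c \in corners V sg) = (c.1 \in V) && (c.2 <= size (sg c.1)).
Proof.
case: c => u i /=; apply/allpairsPdep/andP => [[x [j [xV]]]|[uV iu]].
  by rewrite mem_iota /= add0n ltnS => h [-> ->].
by exists u, i; rewrite mem_iota /= add0n ltnS.
Qed.

Lemma corners_uniq V sg : uniq V -> uniq (corners V sg).
Proof.
move=> UV; apply: allpairs_uniq_dep => //; first by move=> *; apply: iota_uniq.
by move=> [a b] [c d] _ _ /= [-> ->].
Qed.

(** By [handshake]: 2(n - 1) + n = 3n - 2. *)
Lemma size_corners V sg : uniq V -> dtree V sg -> 3 * size V - 2 <= size (corners V sg).
Proof.
move=> UV T; rewrite size_allpairs_dep sumnE big_map.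
under eq_bigr do rewrite size_iota -addn1.
rewrite big_split /= sum1_size; have := handshake UV T.
move: (\sum_(x <- V) _) (size V) => S l; lia.
Qed.

Section PairCount.
Variables (n : nat) (w w' : seq digit).
Let M := pattern_size w.
Let M' := pattern_size w'.
Let V := iota 1 n.
Hypotheses (w_gt0 : 0 < size w) (w'_gt0 : 0 < size w').
Hypotheses (vw : valid_first (digits_of w 0)) (vw' : valid_first (digits_of w' 0)).
Hypotheses (nM : M + M < n) (nM' : M' + M' < n) .

Let UV : uniq V. Proof. exact: iota_uniq. Qed.

(** Attach the first pattern at a corner of a decorated tree on the remaining
labels, and then the second one at a corner of an old node, so that it does not
disturb the first. *)
Lemma count_occurs_on z1 z2 : uniq (z1 ++ z2) -> {subset z1 ++ z2 <= V} ->
  size z1 = M -> size z2 = M' ->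
  size (dtrees (iota 1 (n - (M + M')))) * (3 * (n - (M + M')) - 2) ^ 2 <=
  count (fun sg => `[< occurs_on sg w z1 /\ occurs_on sg w' z2 >]) (dtrees V).
Proof.
move=> Uz zV s1 s2.
pose V' := [seq x <- V | x \notin z1 ++ z2].
have UV' : uniq V' by rewrite filter_uniq.
have sV' : size V' = n - (M + M').
  have /perm_size : perm_eq V ((z1 ++ z2) ++ V').
    apply: uniq_perm => //.
      rewrite cat_uniq Uz UV' andbT; apply/hasPn => x; by rewrite mem_filter => /andP[].
    move=> x; rewrite mem_cat mem_filter.
    by case: (boolP (x \in z1 ++ z2)) => [/zV ->|].
  by rewrite size_iota !size_cat s1 s2 => h; rewrite [in RHS]h addKn.
have z1V' x : x \in z1 -> x \notin V'.
  by move=> h; rewrite mem_filter mem_cat h.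
have U1 : uniq z1 by move: Uz; rewrite cat_uniq => /and3P[].
have U2 : uniq z2 by move: Uz; rewrite cat_uniq => /and3P[].
have z21 x : x \in z2 -> x \notin z1.
  by move: Uz; rewrite cat_uniq => /and3P[_ /hasPn h _] /h.
have z2V' x : x \in z2 -> x \notin z1 ++ V'.
  by move=> h; rewrite mem_cat negb_or z21 // mem_filter mem_cat h orbT.
pose K := [seq (sg, c) | sg <- dtrees V', c <- [seq (c1, c2) | c1 <- corners V' sg, c2 <- corners V' sg]].
pose F1 (x : adjacency * ((nat * nat) * (nat * nat))) :=
  attach x.1 (digits_of w) (size w) z1 x.2.1.1 x.2.1.2.
pose F (x : adjacency * ((nat * nat) * (nat * nat))) : adjacency :=
  attach (F1 x) (digits_of w') (size w') z2 x.2.2.1 x.2.2.2.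
have UK : uniq K.
  apply: allpairs_uniq_dep; first exact: dtrees_uniq.
    move=> sg _; apply: allpairs_uniq; [exact: corners_uniq..|].
    by move=> [a b] [c d] _ _ /= [-> ->].
  by move=> [a b] [c d] _ _ /= [-> ->].
have KP x : x \in K -> [/\ dtree V' x.1, x.2.1.1 \in V' /\ x.2.1.2 <= size (x.1 x.2.1.1) &
    x.2.2.1 \in V' /\ x.2.2.2 <= size (x.1 x.2.2.1)].
  move=> /allpairsPdep[sg [c [sgD /allpairsP[[c1 c2] /= [h1 h2 ->]] ->]]] /=.
  by move: sgD h1 h2; rewrite mem_dtrees // !mem_corners => /asboolP T /andP[? ?] /andP[? ?].
have T1 x : x \in K -> dtree (z1 ++ V') (F1 x).
  by move=> /KP[T [u1 i1] _]; apply: attach_dtree.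
have in1 x : x \in K -> x.2.2.1 \in z1 ++ V'.
  by move=> /KP[_ _ [u2 _]]; rewrite mem_cat u2 orbT.
have inj : {in K &, injective F}.
  move=> x y xK yK e; have [Tx [ux ix] [ux' ix']] := KP x xK.
  have [Ty [uy iy] [uy' iy']] := KP y yK.
  have grow t : t \in K -> size (t.1 t.2.2.1) <= size (F1 t t.2.2.1).
    move=> tK; have [Tt [ut it] [ut' it']] := KP t tK; rewrite /F1 /attach.
    case: ifP => [/z1V'|_]; first by rewrite ut'.
    by case: eqP => [->|_] //; rewrite (perm_size (perm_insert_at _ _ _)) /=.
  have [e1 e2 e3] := attach_inj (T1 x xK) (T1 y yK) w'_gt0 s2 U2 z2V' (in1 x xK) (in1 y yK)
     (leq_trans ix' (grow x xK)) (leq_trans iy' (grow y yK)) e.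
  have [e4 e5 e6] := attach_inj Tx Ty w_gt0 s1 U1 z1V' ux uy ix iy e1.
  move: e2 e3 e4 e5 e6; case: (x) => [a [[b c] [d f]]]; case: (y) => [a' [[b' c'] [d' f']]] /=.
  by move=> -> -> -> -> ->.
have FV x : x \in K -> F x \in [seq sg <- dtrees V | `[< occurs_on sg w z1 /\ occurs_on sg w' z2 >]].
  move=> xK; have [Tx [ux ix] [ux' ix']] := KP x xK.
  have E1 := attach_embeds x.1 x.2.1.2 s1 U1 z1V' ux.
  have E2 := attach_embeds (F1 x) x.2.2.2 s2 U2 z2V' (in1 x xK).
  have mapz u z : map (nth u z) (iota 0 (size z)) = z by rewrite map_nth_iota0 // take_size.
  rewrite mem_filter mem_dtrees //; apply/andP; split; apply/asboolP.
    split; last by exists (nth x.2.2.1 z2); [rewrite -/M' -s2 mapz | exact: E2].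
    exists (nth x.2.1.1 z1); first by rewrite -/M -s1 mapz.
    case: E1 => inj1 e1; split => // j jM; rewrite /F attach_out; first exact: e1.
      by apply/negP => /z21; rewrite mem_nth // s1.
    by apply: contraTneq ux' => <-; apply: z1V'; rewrite mem_nth // s1.
  apply: dtree_eq_mem (attach_dtree x.2.2.2 (T1 x xK) w'_gt0 s2 U2 z2V' (in1 x xK)).
  move=> y; rewrite !mem_cat mem_filter mem_cat -/V.
  have := zV y; rewrite mem_cat.
  by case: (y \in z1); case: (y \in z2) => //= h; rewrite ?h.
have := leq_size_inj UK inj FV; rewrite size_filter; apply: leq_trans.
rewrite size_allpairs_dep sumnE big_map.
apply: (@leq_trans (\sum_(sg <- dtrees V') (3 * size V' - 2) ^ 2)).
  rewrite big_const_seq count_predT iter_addn_0 mulnC sV' leq_mul2l.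
  by rewrite leq_dtrees ?iota_uniq ?size_iota ?orbT // sV'.
rewrite big_seq [leqRHS]big_seq; apply: leq_sum => sg; rewrite mem_dtrees // => /asboolP T.
by rewrite size_allpairs mulnn leq_sqr; apply: size_corners.
Qed.

Lemma occurs_on_head sg z1 : occurs_on sg w z1 -> 0 < M -> occurs sg w (nth 0 z1 0).
Proof.
move=> [phi <- E] M0; exists phi => //; rewrite (nth_map 0) ?size_iota //.
by rewrite nth_iota.
Qed.

End PairCount.

Lemma pattern_size_gt0 w : 0 < size w -> 0 < pattern_size w.
Proof. by move=> h; apply: leq_trans h (off_ge _ _). Qed.

Lemma occurs_on_unique n w sg z z' : 0 < size w -> valid_first (digits_of w 0) ->
  pattern_size w + pattern_size w < n -> dtree (iota 1 n) sg -> occurs_on sg w z -> occurs_on sg w z' ->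
  nth 0 z 0 = nth 0 z' 0 -> z = z'.
Proof.
move=> w0 vw nM T [phi <- E] [phi' <- E'] e.
have M0 := pattern_size_gt0 w0.
rewrite !(nth_map 0) ?size_iota // !nth_iota // !addn0 in e.
have [|_ h] := pattern_unique T w0 (iota_uniq _ _) vw vw E E' e.
  by rewrite size_iota.
apply/eq_in_map => j; rewrite mem_iota /= add0n => jM; apply: h; exact: ltnW.
Qed.

Lemma sum_bool_count (T : Type) (P : pred T) (s : seq T) : \sum_(x <- s) P x = count P s.
Proof. by elim: s => [|x s IH]; rewrite ?big_nil // big_cons IH. Qed.

(** Summing [count_occurs_on] over all labellings; by [occurs_on_unique] a
labelling is determined by the nodes at which the two patterns occur. *)
Lemma occurrences_pair n w w' :
  0 < size w -> 0 < size w' -> valid_first (digits_of w 0) -> valid_first (digits_of w' 0) ->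
  pattern_size w + pattern_size w < n -> pattern_size w' + pattern_size w' < n ->
  n ^_ (pattern_size w + pattern_size w') *
  (size (dtrees (iota 1 (n - (pattern_size w + pattern_size w')))) *
     (3 * (n - (pattern_size w + pattern_size w')) - 2) ^ 2) <=
  \sum_(sg <- dtrees (iota 1 n)) occurrences sg n w * occurrences sg n w'.
Proof.
move=> w0 w0' vw vw' nM nM'; set V := iota 1 n.
have UV : uniq V by exact: iota_uniq.
pose M := pattern_size w; pose k := pattern_size w + pattern_size w'.
pose P z sg := `[< occurs_on sg w (take M z) /\ occurs_on sg w' (drop M z) >].
have zP z : z \in inj_seqs k V -> [/\ uniq z, {subset z <= V}, size (take M z) = M & size (drop M z) = pattern_size w'].
  move=> /(mem_inj_seqs UV)[h1 h2 h3]; split=> //.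
    by rewrite size_takel // h3 leq_addr.
  by rewrite size_drop h3 /k /M addKn.
apply: (@leq_trans (\sum_(z <- inj_seqs k V) \sum_(sg <- dtrees V) P z sg)).
  rewrite -{1}(size_iota 1 n) -size_inj_seqs -sum1_size big_distrl /=.
  rewrite big_seq [leqRHS]big_seq; apply: leq_sum => z /zP[h1 h2 h3 h4].
  rewrite mul1n sum_bool_count.
  by apply: count_occurs_on => //; rewrite cat_take_drop.
rewrite exchange_big /= big_seq [leqRHS]big_seq; apply: leq_sum => sg.
rewrite mem_dtrees // => /asboolP T.
rewrite sum_bool_count.
rewrite /occurrences -!size_filter -(size_allpairs pair).
apply: (@leq_size_inj _ _ (fun z => (nth 0 z 0, nth 0 (drop M z) 0))).
- by rewrite filter_uniq // inj_seqs_uniq.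
- move=> z z'; rewrite !mem_filter => /andP[/asboolP[z1 z2] zk] /andP[/asboolP[z1' z2'] zk'] [e1 e2].
  have M0 : 0 < M by apply: pattern_size_gt0.
  rewrite -(cat_take_drop M z) -(cat_take_drop M z'); congr cat.
    by apply: occurs_on_unique T z1 z1' _ => //; rewrite !nth_take.
  exact: occurs_on_unique T z2 z2' _.
- move=> z; rewrite mem_filter => /andP[/asboolP[z1 z2] /zP[h1 h2 h3 h4]].
  have M0 : 0 < M by apply: pattern_size_gt0.
  have M0' : 0 < pattern_size w' by apply: pattern_size_gt0.
  apply/allpairsP; exists (nth 0 z 0, nth 0 (drop M z) 0); split=> //=; rewrite mem_filter.
    rewrite -(nth_take 0 M0); apply/andP; split.
      by apply/asboolP; apply: occurs_on_head z1 _.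
    by apply: h2; apply: (@mem_take M); rewrite mem_nth // h3.
  apply/andP; split; first by apply/asboolP; apply: occurs_on_head z2 _.
  by apply: h2; apply: (@mem_drop M); rewrite mem_nth // h4.
Qed.

HB.instance Definition _ := gen_eqMixin sgraph.
HB.instance Definition _ := gen_choiceMixin sgraph.

(** * The law of the random tree *)
Lemma card_fset_set_seq (S : set nat) (s : seq nat) :
  uniq s -> (forall x, S x <-> x \in s) -> #|` fset_set S | = size s.
Proof.
move=> us Ss; have -> : S = [set` s] by apply/seteqP; split => x /= /Ss.
apply: perm_size; apply: uniq_perm => //.
by move=> x; rewrite in_fset_set; [apply/asboolP/idP | exact: finite_seq].
Qed.

Definition tree_of (n : nat) (sg : adjacency) : sgraph := decorated_graph [set` iota 1 n] sg.

Definition nbrs (T : sgraph) (v : nat) : seq nat := fset_set [set u | adj T v u].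

Lemma node_iota n x : ((1 <= x <= n)%N) = (x \in iota 1 n).
Proof. by rewrite mem_iota add1n ltnS. Qed.

Lemma labelled_adj n T x y : labelled_tree n T -> adj T x y -> x \in iota 1 n.
Proof. by move=> [nT _] /adj_nodes; rewrite nT /= node_iota. Qed.

Lemma mem_nbrs n T x y : labelled_tree n T -> (y \in nbrs T x) = adj T x y.
Proof.
move=> LT; rewrite /nbrs in_fset_set; last first.
  apply: (sub_finite_set _ (finite_seq (iota 1 n))) => z /= xz.
  by apply: (labelled_adj (y := x) LT); rewrite adj_sym.
by apply/asboolP/idP.
Qed.

(** A decoration is an independent choice of a permutation of each neighbourhood. *)
Lemma decorations_count n T : labelled_tree n T ->
  count (fun sg => tree_of n sg == T) (dtrees (iota 1 n)) =
  \prod_(1 <= i < n.+1) (degree T i)`!.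
Proof.
move=> LT; have [nT tT] := LT.
have UV := iota_uniq 1 n.
rewrite -size_filter /index_iota subSS subn0.
transitivity (size (fun_enum (iota 1 n) (fun x => permutations (nbrs T x)))); last first.
  rewrite size_fun_enum; apply: eq_bigr => x _.
  by rewrite size_permutations // fset_uniq.
apply: perm_size; apply: uniq_perm.
- by rewrite filter_uniq // dtrees_uniq.
- by apply: fun_enum_uniq => // x; apply: permutations_uniq.
move=> sg; rewrite mem_filter mem_dtrees //; apply/andP/mem_fun_enum => //.
- move=> [/eqP e /asboolP TT]; split; last exact: dt_out TT.
  move=> x xV; rewrite mem_permutations; apply: uniq_perm; rewrite ?(dt_uniq TT) ?fset_uniq //.
  by move=> y; rewrite (mem_nbrs _ _ LT) -e (dtree_adj _ _ TT).
- move=> [h1 h2].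
  have mem x y : (y \in sg x) = adj T x y.
    case: (boolP (x \in iota 1 n)) => xV.
      have := h1 x xV; rewrite mem_permutations => /perm_mem ->.
      by rewrite (mem_nbrs _ _ LT).
    by rewrite h2 // in_nil; apply/esym/negP => /(labelled_adj LT); apply/negP.
  have eT : tree_of n sg = T.
    apply: sgraph_eq => /= [|x y].
      by rewrite nT; apply/seteqP; split => x /=; rewrite node_iota.
    rewrite [LHS]decorated_adjE !mem [adj T y x]adj_sym andbb.
    case xy: (adj T x y); rewrite ?andbF // !mem_setE.
    rewrite (labelled_adj LT xy) (labelled_adj (y := x) LT) 1?adj_sym //= andbT.
    by apply: contraTneq xy => ->; rewrite adj_irr.
  split; first by rewrite eT.
  apply/asboolP; apply: is_tree_dtree => //; last by rewrite -/(tree_of n sg) eT.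
  - move=> x; case: (boolP (x \in iota 1 n)) => xV; last by rewrite h2.
    by have := h1 x xV; rewrite mem_permutations => /perm_uniq ->; rewrite fset_uniq.
  - by move=> x y; rewrite -/(tree_of n sg) eT mem.
Qed.

Lemma tree_of_labelled n sg : (0 < n)%N -> sg \in dtrees (iota 1 n) -> labelled_tree n (tree_of n sg).
Proof.
move=> n0; rewrite mem_dtrees ?iota_uniq // => /asboolP T; split.
  by apply/seteqP; split => x /=; rewrite node_iota.
by apply: dtree_is_tree => //; case: n n0 {T}.
Qed.

Definition total_weight (n : nat) : nat := ((n - 2)`! * 'C(3 * n - 3, n - 2))%N.

Section Law.
Context (R : realType) (n : nat) (d : measure_display) (Omega : measurableType d).
Context (P : probability Omega R) (X : Omega -> sgraph).
Hypothesis n2 : (2 <= n)%N.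
Hypothesis XP : random_Pi_tree n P X.
Let V := iota 1 n.
Let n0 : (0 < n)%N. Proof. by apply: leq_trans n2. Qed.

(** Each tree is counted once for each of its decorations, which is the numerator
of its weight. *)
Lemma random_tree_law (Q : sgraph -> Prop) :
  P [set w | Q (X w)] =
  ((count (fun sg => `[< Q (tree_of n sg) >]) (dtrees V))%:R / (total_weight n)%:R)%:E.
Proof.
have [lab law] := XP.
pose L := [seq T <- undup (map (tree_of n) (dtrees V)) | `[< Q T >]].
have UL : uniq L by rewrite filter_uniq // undup_uniq.
have inL T : T \in L -> labelled_tree n T.
  rewrite mem_filter mem_undup => /andP[_ /mapP[sg sgD ->]]; exact: tree_of_labelled.
have -> : [set w | Q (X w)] = \bigcup_(T in [set` L]) X @^-1` [set T].
  apply/seteqP; split => w /=; last first.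
    by move=> [T /=]; rewrite mem_filter => /andP[/asboolP QT _] ->.
  move=> QX; exists (X w) => //=; rewrite mem_filter mem_undup; apply/andP; split.
    exact/asboolP.
  have : (0 < count (fun sg => tree_of n sg == X w) (dtrees V))%N.
    rewrite (decorations_count (lab w)); apply: prodn_gt0 => i; exact: fact_gt0.
  rewrite -has_count => /hasP[sg sgD /eqP <-]; exact: map_f.
rewrite measure_fin_bigcup //; last 3 first.
- exact: finite_seq.
- by move=> T T' _ _ [w []] /= -> ->.
- by move=> T /inL /law[].
rewrite -fsbig_seq //.
transitivity (\sum_(T <- L)
    ((count (fun sg => tree_of n sg == T) (dtrees V))%:R / (total_weight n)%:R : R)%:E)%E.
  apply: eq_big_seq => T /inL LT; rewrite (decorations_count LT); exact: (law T LT).2.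
rewrite sumEFin -mulr_suml -natr_sum; congr ((_%:R / _)%:E).
under eq_bigr do rewrite -sum_bool_count.
rewrite exchange_big /= -sum_bool_count; apply: eq_big_seq => sg sgD.
rewrite sum_bool_count (eq_count (a2 := pred1 (tree_of n sg))); last by move=> T /=; rewrite eq_sym.
by rewrite count_uniq_mem // mem_filter mem_undup map_f ?andbT.
Qed.

(** No enumeration of trees is needed: the hypothesis that the weights are those
of a probability already contains the count. *)
Lemma size_dtrees : size (dtrees V) = total_weight n.
Proof.
have := random_tree_law (fun=> True).
rewrite (_ : [set w | True] = setT) // probability_setT.
have -> : count (fun=> `[< True >]) (dtrees V) = size (dtrees V).
  by rewrite (eq_count (a2 := predT)) ?count_predT // => sg; exact: asboolT.
move=> [] h.
have W0 : ((total_weight n)%:R != 0 :> R)%R.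
  rewrite pnatr_eq0 -lt0n /total_weight muln_gt0 fact_gt0 bin_gt0; lia.
move/esym/(congr1 (fun x => x * (total_weight n)%:R)%R): h; rewrite divfK // mul1r => /eqP.
by rewrite eqr_nat => /eqP.
Qed.

End Law.

(** * Masses of forests, blocks and patterns *)
Fixpoint forest_code (f : forest) : GenTree.tree unit :=
  if f is Fcons l r s then GenTree.Node 0 [:: forest_code l; forest_code r; forest_code s]
  else GenTree.Leaf tt.

Fixpoint forest_decode (t : GenTree.tree unit) : option forest :=
  match t with
  | GenTree.Leaf _ => Some Fnil
  | GenTree.Node _ [:: a; b; c] =>
    match forest_decode a, forest_decode b, forest_decode c with
    | Some l, Some r, Some s => Some (Fcons l r s)
    | _, _, _ => None
    end
  | _ => None
  end.

Lemma forest_codeK : pcancel forest_code forest_decode.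
Proof. by elim=> //= l -> r -> s ->. Qed.

HB.instance Definition _ := Countable.copy forest (pcan_type forest_codeK).
HB.instance Definition _ := Countable.copy digit (bool * forest * forest * forest)%type.

(** The forests of height less than [h], as ternary trees. *)
Fixpoint forests (h : nat) : seq forest :=
  if h is h'.+1 then
    Fnil :: [seq Fcons l.1 l.2 s | l <- [seq (l, r) | l <- forests h', r <- forests h'],
                                   s <- forests h']
  else [::].

Lemma mem_forests h l r s :
  (Fcons l r s \in forests h.+1) = [&& l \in forests h, r \in forests h & s \in forests h].
Proof.
rewrite /= inE /=; apply/allpairsP/and3P => [[[[a b] c] /= [/allpairsP[[a' b'] /= [? ? [-> ->]]] ? [-> -> ->]]] //|[? ? ?]].
by exists ((l, r), s); split=> //=; apply/allpairsP; exists (l, r).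
Qed.

Lemma forests_uniq h : uniq (forests h).
Proof.
elim: h => //= h IH; apply/andP; split.
  by apply/negP => /allpairsP[[[a b] c] /= [_ _]].
apply: allpairs_uniq => //.
  by apply: allpairs_uniq => // -[a b] [c d] _ _ /= [-> ->].
by move=> [[a b] c] [[a' b'] c'] _ _ /= [-> -> ->].
Qed.

Lemma forests_mono h : {subset forests h <= forests h.+1}.
Proof.
elim: h => // h IH [|l r s]; first by rewrite /= !inE.
by rewrite !mem_forests => /and3P[/IH -> /IH -> /IH ->].
Qed.

Lemma forests_homo h h' : (h <= h')%N -> {subset forests h <= forests h'}.
Proof.
move=> /subnK <-; elim: (h' - h)%N => //= k IH f /IH; exact: forests_mono.
Qed.

Lemma in_forests f : exists h, f \in forests h.
Proof.
elim: f => [|l [a ha] r [b hb] s [c hc]]; first by exists 1.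
exists (maxn a (maxn b c)).+1; rewrite mem_forests.
by rewrite (forests_homo _ ha) ?(forests_homo _ hb) ?(forests_homo _ hc) // !leq_max leqnn ?orbT.
Qed.

Definition digits (h : nat) : seq digit :=
  [seq (x.1, x.2, y.1, y.2) | x <- [seq (b, A) | b <- [:: true; false], A <- forests h],
                             y <- [seq (B, C) | B <- forests h, C <- forests h]].

Lemma mem_pairs (T1 T2 : eqType) (s : seq T1) (t : seq T2) x :
  (x \in [seq (a, b) | a <- s, b <- t]) = (x.1 \in s) && (x.2 \in t).
Proof.
apply/allpairsP/andP => [[[a b] [h1 h2 ->]] //|[h1 h2]].
by exists x; split=> //; case: x {h1 h2}.
Qed.

Lemma mem_digits h b A B C : ((b, A, B, C) \in digits h) =
  [&& A \in forests h, B \in forests h & C \in forests h].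
Proof.
apply/allpairsP/and3P => [[[[b' A'] [B' C']] [+ + [_ -> -> ->]]]|[h1 h2 h3]].
  by rewrite !mem_pairs => /andP[_ ?] /andP[].
exists ((b, A), (B, C)); rewrite !mem_pairs /= h1 h2 h3; split => //.
by case: b.
Qed.

Lemma digits_uniq h : uniq (digits h).
Proof.
have p2 (T1 T2 : eqType) (s : seq T1) (t : seq T2) : uniq s -> uniq t -> uniq [seq (a, b) | a <- s, b <- t].
  by move=> us ut; apply: allpairs_uniq => // [[a b] [c d]] _ _ /= [-> ->].
apply: allpairs_uniq; [apply: p2 | apply: p2 |]; rewrite ?forests_uniq //.
by move=> [[a b] [c d]] [[a' b'] [c' d']] _ _ /= [-> -> -> ->].
Qed.

Lemma in_digits (s : seq digit) : exists h, {subset s <= digits h}.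
Proof.
elim: s => [|[[[b A] B] C] s [h IH]]; first by exists 0.
have [a ha] := in_forests A; have [b' hb] := in_forests B; have [c hc] := in_forests C.
exists (maxn h (maxn a (maxn b' c))) => d; rewrite inE => /orP[/eqP->|/IH].
  rewrite mem_digits (forests_homo _ ha) ?(forests_homo _ hb) ?(forests_homo _ hc) //;
  by rewrite !leq_max leqnn ?orbT.
case: d => [[[? ?] ?] ?]; rewrite !mem_digits => /and3P[? ? ?].
by apply/and3P; split; apply: (@forests_homo h); rewrite ?leq_max ?leqnn.
Qed.

Section Mass.
Variable R : realType.
Local Open Scope ring_scope.

(** The radius of convergence of the generating function of ternary trees. *)
Definition node_mass : R := 4 / 27.

(** A ternary Galton-Watson tree that branches with probability 1/3: a tree with
[k] internal nodes has 2k + 1 leaves, and (1/3)^k (2/3)^(2k+1) = (2/3) (4/27)^k. *)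
Definition forest_mass (f : forest) : R := 2 / 3 * node_mass ^+ forest_size f.

Definition forest_mass_upto (h : nat) : R := \sum_(f <- forests h) forest_mass f.

Lemma forest_mass_cons l r s : forest_mass (Fcons l r s) = forest_mass l * forest_mass r * forest_mass s / 3.
Proof.
rewrite /forest_mass /= exprS !exprD.
move: (node_mass ^+ forest_size l) (node_mass ^+ forest_size r) (node_mass ^+ forest_size s) => x y z; rewrite /node_mass; lra.
Qed.

Lemma forest_mass_uptoS h : forest_mass_upto h.+1 = 2 / 3 + forest_mass_upto h ^+ 3 / 3.
Proof.
rewrite /forest_mass_upto /= big_cons big_allpairs_dep /= big_allpairs_dep /=.
rewrite {1}/forest_mass expr0 mulr1; congr (_ + _).
under eq_bigr do under eq_bigr do under eq_bigr do rewrite forest_mass_cons.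
under eq_bigr do under eq_bigr do rewrite -mulr_suml -mulr_sumr.
under eq_bigr do rewrite -mulr_suml -mulr_suml -mulr_sumr.
by rewrite -!mulr_suml !exprS expr0 mulr1 !mulrA.
Qed.

Lemma forest_mass_upto_ge0 h : 0 <= forest_mass_upto h.
Proof.
apply: sumr_ge0 => f _; apply: mulr_ge0; first lra.
by apply: exprn_ge0; rewrite /node_mass; lra.
Qed.

Lemma forest_mass_upto_le1 h : forest_mass_upto h <= 1.
Proof.
elim: h => [|h IH]; first by rewrite /forest_mass_upto big_nil.
rewrite forest_mass_uptoS; have h0 := forest_mass_upto_ge0 h.
have h3 : forest_mass_upto h ^+ 3 <= 1 by exact: exprn_ile1.
lra.
Qed.

(** The deficit e = 1 - g satisfies e' = e - e^2 + e^3/3 <= e - (2/3) e^2, and it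
decreases; adding up the losses (2/3) e^2, each at least the last one, shows
that it tends to 0. *)
Lemma forest_mass_upto_deficit h :
  (1 - forest_mass_upto h) + 2 / 3 * h%:R * (1 - forest_mass_upto h) ^+ 2 <= 1.
Proof.
elim: h => [|h IH]; first by rewrite /forest_mass_upto big_nil mulr0 mul0r; lra.
have g0 := forest_mass_upto_ge0 h; have g1 := forest_mass_upto_le1 h.
have E : 1 - forest_mass_upto h.+1 =
  (1 - forest_mass_upto h) - (1 - forest_mass_upto h) ^+ 2 + (1 - forest_mass_upto h) ^+ 3 / 3.
  rewrite forest_mass_uptoS; move: (forest_mass_upto h) => g; lra.
rewrite E; move: g0 g1 IH {E}; move: (forest_mass_upto h) => g g0 g1 IH.
set e := 1 - g in IH *.
have e0 : 0 <= e by rewrite /e; lra.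
have e1 : e <= 1 by rewrite /e; lra.
set e' := e - e ^+ 2 + e ^+ 3 / 3.
have e2 : 0 <= e ^+ 2 by apply: exprn_ge0.
have e3 : e ^+ 3 <= e ^+ 2 by rewrite exprSr ler_piMr.
have e30 : 0 <= e ^+ 3 by apply: exprn_ge0.
have e21 : e ^+ 2 <= e by rewrite expr2 ler_piMr.
have h1 : e' <= e - 2 / 3 * e ^+ 2 by rewrite /e'; lra.
have h0 : 0 <= e' by rewrite /e'; lra.
have h2 : e' ^+ 2 <= e ^+ 2 by rewrite ler_sqr ?nnegrE //; lra.
have h3 : 2 / 3 * h.+1%:R * e' ^+ 2 <= 2 / 3 * h.+1%:R * e ^+ 2.
  by apply: ler_wpM2l => //; apply: mulr_ge0 => //; lra.
have h4 : 2 / 3 * h.+1%:R * e ^+ 2 = 2 / 3 * h%:R * e ^+ 2 + 2 / 3 * e ^+ 2.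
  by rewrite -natr1; lra.
lra.
Qed.

Lemma forest_mass_upto_near1 (eps : R) : 0 < eps -> exists h, 1 - eps <= forest_mass_upto h.
Proof.
move=> eps0.
have [h hh] : exists h : nat, 3 / 2 / eps ^+ 2 < h%:R.
  by exists (Num.bound (3 / 2 / eps ^+ 2)); apply: archi_boundP;
     apply: divr_ge0; [lra | apply: exprn_ge0; lra].
exists h; rewrite leNgt; apply/negP => lt.
have d := forest_mass_upto_deficit h.
have e2 : 0 < eps ^+ 2 by apply: exprn_gt0.
have : 3 / 2 < h%:R * eps ^+ 2 by rewrite -ltr_pdivrMr.
have : eps ^+ 2 <= (1 - forest_mass_upto h) ^+ 2 by rewrite ler_sqr ?nnegrE; lra.
have h0 : 0 <= h%:R :> R by [].
move=> le2; have := ler_wpM2l h0 le2.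
lra.
Qed.

(** The law of the blocks.  Block 0 has an extra factor 3 because only two forests
hang from it: (2/3)^2 = 3 (4/27), whereas (1/2) (2/3)^3 = 4/27. *)
Definition digit_mass (i : nat) (d : digit) : R :=
  if i is 0 then (if valid_first d then 3 * node_mass ^+ digit_size d else 0) else node_mass ^+ digit_size d.

Lemma node_mass_ge0 : 0 <= node_mass. Proof. by rewrite /node_mass; lra. Qed.

Lemma digit_mass_ge0 i d : 0 <= digit_mass i d.
Proof.
have := exprn_ge0 (digit_size d) node_mass_ge0.
by case: i => [|i] /=; first case: ifP; lra.
Qed.

Lemma digit_massS i b A B C :
  digit_mass i.+1 (b, A, B, C) = forest_mass A * forest_mass B * forest_mass C / 2.
Proof.
rewrite /digit_mass /forest_mass /digit_size /= !forest_size_cat exprS !exprD.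
move: (node_mass ^+ forest_size A) (node_mass ^+ forest_size B) (node_mass ^+ forest_size C) => x y z; rewrite /node_mass; lra.
Qed.

Lemma digit_mass0 A C : digit_mass 0 (true, A, Fnil, C) = forest_mass A * forest_mass C.
Proof.
rewrite /digit_mass /forest_mass /digit_size /= !forest_size_cat exprS !exprD.
move: (node_mass ^+ forest_size A) (node_mass ^+ forest_size C) => x y; rewrite /node_mass; lra.
Qed.

Lemma sum_digit_mass h i : \sum_(d <- digits h) digit_mass i d =
  if i is 0 then (0 < h)%:R * forest_mass_upto h ^+ 2 else forest_mass_upto h ^+ 3.
Proof.
rewrite /digits big_allpairs_dep big_allpairs_dep !big_cons big_nil /= addr0.
under eq_bigr do rewrite big_allpairs_dep /=.
under [X in _ + X = _]eq_bigr do rewrite big_allpairs_dep /=.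
case: i => [|i].
  rewrite [X in _ + X]big1 ?addr0 => [|A _]; last by rewrite big1 // => B _; rewrite big1.
  case: h => [|h]; first by rewrite mul0r big_nil.
  have only_nil (F : forest -> R) : (forall l r s, F (Fcons l r s) = 0) ->
      \sum_(B <- forests h.+1) F B = F Fnil.
    move=> F0; rewrite /= big_cons big1_seq ?addr0 // => f /= /allpairsP[p [_ _ ->]].
    exact: F0.
  rewrite mul1r; under eq_bigr => A _.
    rewrite (only_nil (fun B => \sum_(C <- forests h.+1) digit_mass 0 (true, A, B, C))); last first.
      by move=> l r s; rewrite big1.
    under eq_bigr do rewrite digit_mass0.
    rewrite -mulr_sumr; over.
  by rewrite -mulr_suml expr2.
under eq_bigr do under eq_bigr do under eq_bigr do rewrite digit_massS.
have -> : \sum_(A <- forests h) \sum_(B <- forests h) \sum_(C <- forests h)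
     forest_mass A * forest_mass B * forest_mass C / 2 = forest_mass_upto h ^+ 3 / 2.
  under eq_bigr do under eq_bigr do rewrite -mulr_suml -mulr_sumr.
  under eq_bigr do rewrite -mulr_suml -mulr_suml -mulr_sumr.
  by rewrite -!mulr_suml !exprS expr0 mulr1 !mulrA.
lra.
Qed.

Lemma sum_digit_mass_le1 (s : seq digit) i : uniq s -> \sum_(d <- s) digit_mass i d <= 1.
Proof.
move=> us; have [h sh] := in_digits s.
apply: (@le_trans _ _ (\sum_(d <- digits h) digit_mass i d)).
  have e : perm_eq (digits h) (s ++ [seq d <- digits h | d \notin s]).
    apply: uniq_perm; first exact: digits_uniq.
      rewrite cat_uniq us filter_uniq ?digits_uniq // andbT.
      by apply/hasPn => d; rewrite mem_filter => /andP[].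
    by move=> d; rewrite mem_cat mem_filter; case: (boolP (d \in s)) => [/sh ->|].
  by rewrite (perm_big _ e) big_cat /= lerDl sumr_ge0 // => d _; apply: digit_mass_ge0.
have g0 := forest_mass_upto_ge0 h; have g1 := forest_mass_upto_le1 h.
rewrite sum_digit_mass; case: i => [|i]; last exact: exprn_ile1.
by case: h {sh} g0 g1 => [|h] g0 g1; rewrite ?mul0r ?mul1r //; apply: exprn_ile1.
Qed.

Fixpoint word_mass (i : nat) (w : seq digit) : R :=
  if w is d :: w' then digit_mass i d * word_mass i.+1 w' else 1.

Lemma word_mass_ge0 i w : 0 <= word_mass i w.
Proof. by elim: w i => [|d w IH] i //=; apply: mulr_ge0; rewrite ?digit_mass_ge0. Qed.

Lemma word_massS i w : word_mass i.+1 w = node_mass ^+ (\sum_(d <- w) digit_size d).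
Proof.
elim: w i => [|d w IH] i /=; first by rewrite big_nil expr0.
by rewrite IH big_cons exprD.
Qed.

Lemma pattern_sizeE w : pattern_size w = (\sum_(d <- w) digit_size d)%N.
Proof.
rewrite /pattern_size /digits_of; elim/last_ind: w => [|w d IH]; first by rewrite big_nil.
rewrite size_rcons offS -cats1 big_cat big_seq1 -IH; congr addn.
  apply: (@eq_off (size w)) => // i iw; by rewrite nth_cat iw.
by rewrite nth_cat ltnn subnn.
Qed.

Lemma word_mass_valid w : (0 < size w)%N -> valid_first (digits_of w 0) ->
  word_mass 0 w = 3 * node_mass ^+ pattern_size w.
Proof.
case: w => // d w _ /= v; rewrite word_massS pattern_sizeE big_cons exprD mulrA.
by rewrite [valid_first d]v.
Qed.

Lemma word_mass_invalid w : (0 < size w)%N -> ~~ valid_first (digits_of w 0) -> word_mass 0 w = 0.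
Proof. by case: w => // d w _ /= /negPf; rewrite /digits_of /= => ->; rewrite mul0r. Qed.

Fixpoint words (L : seq digit) (k : nat) : seq (seq digit) :=
  if k is k'.+1 then [seq d :: w | d <- L, w <- words L k'] else [:: [::]].

Lemma mem_words L k w : w \in words L k -> size w = k.
Proof.
by elim: k w => [|k IH] w /=; [rewrite inE => /eqP -> | case/allpairsP=> [[d v] /= [_ /IH <- ->]]].
Qed.

Lemma words_uniq L k : uniq L -> uniq (words L k).
Proof.
move=> uL; elim: k => //= k IH; apply: allpairs_uniq => //.
by move=> [a b] [c d] _ _ /= [-> ->].
Qed.

(** Bernoulli's inequality, each factor being at least 1 - 3 (1 - g). *)
Lemma sum_word_mass h k i : (0 < h)%N ->
  1 - 3 * k%:R * (1 - forest_mass_upto h) <= \sum_(w <- words (digits h) k) word_mass i w.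
Proof.
move=> h_gt0; elim: k i => [|k IH] i /=; first by rewrite big_seq1 /=; lra.
rewrite big_allpairs_dep /=.
under eq_bigr do rewrite -mulr_sumr.
rewrite -mulr_suml.
have g0 := forest_mass_upto_ge0 h; have g1 := forest_mass_upto_le1 h.
have dlow : 1 - 3 * (1 - forest_mass_upto h) <= \sum_(d <- digits h) digit_mass i d.
  rewrite sum_digit_mass h_gt0; move: g0 g1; move: (forest_mass_upto h) => g g0 g1.
  have a0 : 0 <= (1 - g) * (2 - g) by apply: mulr_ge0; lra.
  have b0 : 0 <= (1 - g) ^+ 2 * (g + 2) by apply: mulr_ge0; [exact: sqr_ge0 | lra].
  by case: i => [|i]; rewrite ?mul1r; lra.
have d0 : 0 <= \sum_(d <- digits h) digit_mass i d by apply: sumr_ge0 => d _; apply: digit_mass_ge0.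
have d1 := sum_digit_mass_le1 i (digits_uniq h).
have w0 : 0 <= \sum_(w <- words (digits h) k) word_mass i.+1 w.
  by apply: sumr_ge0 => d _; apply: word_mass_ge0.
have w1 : \sum_(w <- words (digits h) k) word_mass i.+1 w <= 1.
  elim: {w0 IH} k i.+1 => [|k IH] j /=; first by rewrite big_seq1.
  rewrite big_allpairs_dep /=; under eq_bigr do rewrite -mulr_sumr.
  rewrite -mulr_suml; apply: mulr_ile1 => //; last exact: sum_digit_mass_le1 (digits_uniq h).
    by apply: sumr_ge0 => d _; apply: digit_mass_ge0.
  by apply: sumr_ge0 => d _; apply: word_mass_ge0.
have wlow := IH i.+1; rewrite -[k.+1%:R]natr1.
set x := \sum_(d <- digits h) digit_mass i d in dlow d0 d1 *.
set y := \sum_(w <- words (digits h) k) word_mass i.+1 w in wlow w0 w1 *.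
have : (1 - x) * y <= 1 - x by rewrite ler_piMr //; lra.
lra.
Qed.

Lemma words_near1 (eps : R) k : 0 < eps ->
  exists h, 1 - eps <= \sum_(w <- words (digits h) k) word_mass 0 w.
Proof.
move=> eps0; have e0 : 0 < eps / (3 * k.+1%:R) by rewrite divr_gt0 // mulr_gt0.
have [h hh] := forest_mass_upto_near1 e0.
have hh1 : 1 - eps / (3 * k.+1%:R) <= forest_mass_upto h.+1.
  apply: le_trans hh _; rewrite /forest_mass_upto.
  have e : perm_eq (forests h.+1) (forests h ++ [seq f <- forests h.+1 | f \notin forests h]).
    apply: uniq_perm; first exact: forests_uniq.
      rewrite cat_uniq forests_uniq filter_uniq ?forests_uniq // andbT.
      by apply/hasPn => d; rewrite mem_filter => /andP[].
    move=> d; rewrite mem_cat mem_filter.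
    by case: (boolP (d \in forests h)) => [/forests_mono ->|].
  rewrite (perm_big _ e) big_cat /= lerDl sumr_ge0 // => f _.
  by apply: mulr_ge0; [lra | apply: exprn_ge0; exact: node_mass_ge0].
exists h.+1; apply: le_trans (sum_word_mass k 0 (ltn0Sn h)).
have g1 := forest_mass_upto_le1 h.+1; move: hh1 g1; move: (forest_mass_upto h.+1) => g gh g1.
have g0 : 0 <= 1 - g by lra.
have h1 : 3 * k.+1%:R * (1 - g) <= eps.
  rewrite mulrC -ler_pdivlMr ?mulr_gt0 //.
  by rewrite lerBlDr addrC -lerBlDr.
have h2 : 3 * k%:R * (1 - g) <= 3 * k.+1%:R * (1 - g).
  by apply: ler_wpM2r => //; apply: ler_wpM2l => //; rewrite ler_nat.
lra.
Qed.

End Mass.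

Local Notation pickle := choice.pickle.

Section Coding.
Variable R : realType.
Local Open Scope ring_scope.
Notation digit_mass := (@digit_mass R).
Notation word_mass := (@word_mass R).

Definition code_mass (i k : nat) : R := oapp (digit_mass i) 0 (@pickle_inv digit k).

Definition cumul (i n : nat) : R := \sum_(0 <= k < n) code_mass i k.

Lemma code_mass_ge0 i k : 0 <= code_mass i k.
Proof. by rewrite /code_mass; case: pickle_inv => //= d; apply: digit_mass_ge0. Qed.

Lemma cumul_homo i m n : (m <= n)%N -> cumul i m <= cumul i n.
Proof.
move=> mn; rewrite /cumul (big_cat_nat (leq0n m) mn) //= lerDl sumr_ge0 // => k _.
exact: code_mass_ge0.
Qed.

Lemma cumul_ge0 i n : 0 <= cumul i n.
Proof. by apply: sumr_ge0 => k _; apply: code_mass_ge0. Qed.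

Lemma cumul_pickle i (d : digit) : cumul i (pickle d).+1 = cumul i (pickle d) + digit_mass i d.
Proof. by rewrite /cumul big_nat_recr //= /code_mass pickleK_inv. Qed.

Lemma cumul_le1 i n : cumul i n <= 1.
Proof.
rewrite /cumul /index_iota subn0.
have -> : \sum_(k <- iota 0 n) code_mass i k =
          \sum_(d <- pmap (@pickle_inv digit) (iota 0 n)) digit_mass i d.
  elim: (iota 0 n) => [|k s IH] /=; first by rewrite !big_nil.
  rewrite big_cons IH /code_mass.
  by case: pickle_inv => [d|] /=; rewrite ?big_cons ?add0r.
apply: sum_digit_mass_le1; apply: (pmap_uniq (@pickle_invK digit)); exact: iota_uniq.
Qed.

Fixpoint left_end (i : nat) (w : seq digit) : R :=
  if w is d :: w' then cumul i (pickle d) + digit_mass i d * left_end i.+1 w' else 0.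

(** Words are coded by nested half-open intervals of length [word_mass], as in a
numeration system whose digits have unequal frequencies. *)
Definition coded (i : nat) (w : seq digit) (x : R) : bool :=
  left_end i w <= x < left_end i w + word_mass i w.

Lemma left_end_ge0 i w : 0 <= left_end i w.
Proof.
by elim: w i => [|d w IH] i //=; rewrite addr_ge0 ?cumul_ge0 ?mulr_ge0 ?digit_mass_ge0.
Qed.

Lemma right_end_le1 i w : left_end i w + word_mass i w <= 1.
Proof.
elim: w i => [|d w IH] i /=; first by rewrite add0r.
rewrite -addrA -mulrDr; apply: le_trans (cumul_le1 i (pickle d).+1).
by rewrite cumul_pickle lerD2l ler_piMr ?digit_mass_ge0.
Qed.

Lemma coded_cons i (d : digit) w x : coded i (d :: w) x ->
  [/\ 0 < digit_mass i d, cumul i (pickle d) <= x < cumul i (pickle d).+1 &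
      coded i.+1 w ((x - cumul i (pickle d)) / digit_mass i d)].
Proof.
rewrite /coded cumul_pickle /=; set p := digit_mass i d; set s := cumul i _.
set l := left_end _ _; set m := word_mass _ _ => /andP[h1 h2].
have p0 : 0 <= p by apply: digit_mass_ge0.
have l0 : 0 <= l by apply: left_end_ge0.
have lm : l + m <= 1 by apply: right_end_le1.
have pgt : 0 < p.
  rewrite lt0r p0 andbT; apply: contraTneq (le_lt_trans h1 h2) => ->.
  by rewrite !mul0r !addr0 ltxx.
have pl : 0 <= p * l by apply: mulr_ge0.
have plm : p * (l + m) <= p by rewrite ler_piMr.
rewrite mulrDr in plm.
split => //; first by apply/andP; split; lra.
rewrite ler_pdivlMr // ltr_pdivrMr // mulrDl ![_ * p]mulrC.
by apply/andP; split; lra.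
Qed.

Lemma coded_unique i w w' x : size w = size w' -> coded i w x -> coded i w' x -> w = w'.
Proof.
elim: w w' i x => [|d w IH] [|d' w'] // i x [sw] /coded_cons[p0 /andP[h1 h2] c].
move=> /coded_cons[p0' /andP[h1' h2'] c'].
have dd : d = d'.
  have [e|ne] := eqVneq (pickle d) (pickle d'); first exact: (pcan_inj choice.pickleK) e.
  exfalso; case: (ltngtP (pickle d) (pickle d')) ne => // lt _.
    by have := lt_le_trans h2 (le_trans (cumul_homo i lt) h1'); rewrite ltxx.
  by have := lt_le_trans h2' (le_trans (cumul_homo i lt) h1); rewrite ltxx.
by subst d'; rewrite (IH w' i.+1 _ sw c c').
Qed.

Lemma coded_take i w k x : coded i w x -> coded i (take k w) x.
Proof.
elim: w i k x => [|d w IH] i [|k] x //.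
  move=> /coded_cons[p0 /andP[h1 h2] c].
  rewrite /coded /= add0r (le_trans (cumul_ge0 _ _) h1) /=.
  exact: lt_le_trans h2 (cumul_le1 _ _).
move=> /coded_cons[p0 _ /(IH _ k)]; rewrite /coded /=.
rewrite ler_pdivlMr // ltr_pdivrMr // mulrDl ![_ * digit_mass i d]mulrC => /andP[h1 h2].
by apply/andP; split; lra.
Qed.

Lemma coded01 i w x : coded i w x -> 0 <= x < 1.
Proof. by move=> /(coded_take 0); rewrite take0 /coded /= add0r. Qed.

(** Reals outside all intervals of a given level get a default digit, so that
every real yields an infinite tree. *)
Definition digit_at (x : R) (i : nat) : digit :=
  if pselect (exists w, size w = i.+1 /\ coded 0 w x) is left h
  then last digit0 (projT1 (cid h)) else digit0.

Lemma digit_at_coded w x i : coded 0 w x -> (i < size w)%N -> digit_at x i = nth digit0 w i.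
Proof.
move=> c iw; have ct := coded_take i.+1 c.
have st : size (take i.+1 w) = i.+1 by rewrite size_takel.
rewrite /digit_at; case: pselect => [h|]; last by case; exists (take i.+1 w).
case: cid => v /= [sv cv]; rewrite (coded_unique _ cv ct) ?sv ?st //.
by rewrite -nth_last st /= nth_take.
Qed.

Lemma measurable_coded i w : measurable [set x : R | coded i w x].
Proof.
rewrite (_ : [set x | _] = `[left_end i w, left_end i w + word_mass i w[%classic).
  exact: measurable_itv.
by apply/seteqP; split=> x /=; rewrite in_itv.
Qed.

Lemma measurable_exists d (T : measurableType d) (I : countType) (F : I -> set T) :
  (forall i, measurable (F i)) -> measurable [set x | exists i, F i x].
Proof.
move=> mF; rewrite (_ : [set x | _] = \bigcup_k (oapp F set0 (@choice.unpickle I k))).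
  apply: bigcupT_measurable => k; case: choice.unpickle => [i|] //=; exact: mF.
apply/seteqP; split=> x /=.
  by move=> [i Fx]; exists (pickle i) => //; rewrite choice.pickleK.
by move=> [k _]; case: choice.unpickle => //= i Fx; exists i.
Qed.

Lemma measurable_and_prop d (T : measurableType d) (Q : Prop) (A : set T) :
  measurable A -> measurable [set x | Q /\ A x].
Proof.
move=> mA; case: (pselect Q) => q.
  by rewrite (_ : [set x | _] = A) //; apply/seteqP; split => x /=; [case | split].
by rewrite (_ : [set x | _] = set0) //; apply/seteqP; split => x //= [].
Qed.

Lemma measurable_digit_at i (d : digit) : measurable [set x : R | digit_at x i = d].
Proof.
pose Cd (Q : seq digit -> Prop) := [set x : R | exists w, (size w = i.+1 /\ Q w) /\ coded 0 w x].
have mC Q : measurable (Cd Q).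
  by apply: measurable_exists => w; apply: measurable_and_prop; apply: measurable_coded.
rewrite (_ : [set x | _] = Cd (fun w => nth digit0 w i = d) `|`
   [set x | d = digit0 /\ (~` Cd (fun=> True)) x]).
  apply: measurableU => //; apply: measurable_and_prop; exact: measurableC.
apply/seteqP; split=> x /=.
  case: (pselect (Cd (fun=> True) x)) => [[w [[sw _] c]]|nc] e.
    by left; exists w; rewrite -(digit_at_coded c) ?sw // e.
  right; split=> //; rewrite -e /digit_at; case: pselect => // -[w [sw c]].
  by exfalso; apply: nc; exists w.
case=> [[w [[sw <-] c]]|[-> nc]]; first by rewrite (digit_at_coded c) ?sw.
rewrite /digit_at; case: pselect => // -[w [sw c]].
by exfalso; apply: nc; exists w.
Qed.

(** Words form a countable set, so every event about finitely many digits is a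
countable union of intersections of digit events. *)
Lemma measurable_prefix m (Q : seq digit -> Prop) :
  measurable [set x : R | Q (mkseq (digit_at x) m)].
Proof.
have mw k (w : seq digit) : measurable [set x : R | mkseq (digit_at x) k = w].
  elim/last_ind: w k => [|w d IH] [|k].
  - by rewrite (_ : [set x | _] = setT) //; apply/seteqP; split.
  - by rewrite (_ : [set x | _] = set0) //; apply/seteqP; split.
  - rewrite (_ : [set x | _] = set0) //; apply/seteqP; split => // x /= /(congr1 size).
    by rewrite size_rcons.
  - rewrite (_ : [set x | _] = [set x | mkseq (digit_at x) k = w] `&` [set x | digit_at x k = d]).
      by apply: measurableI => //; apply: measurable_digit_at.
    apply/seteqP; split => x; rewrite /mkset mkseqS; first by move/rcons_inj => [e1 e2]; split.
    by move=> [e1 e2]; rewrite e1 e2.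
rewrite (_ : [set x | _] = [set x | exists w, Q w /\ mkseq (digit_at x) m = w]).
  by apply: measurable_exists => w; apply: measurable_and_prop; exact: mw.
apply/seteqP; split => x; rewrite /mkset; last by move=> [w [Qw ->]].
by move=> Qx; exists (mkseq (digit_at x) m).
Qed.

Definition coded_graph (x : R) : rooted_graph := limit_graph (digit_at x).

Lemma adj_coded_graph x u v :
  adj (coded_graph x) u v = (v \in nb (nth digit0 (mkseq (digit_at x) u.+1)) u).
Proof.
rewrite /coded_graph limit_adjE (@eq_nb u.+1 (digit_at x) (nth digit0 (mkseq (digit_at x) u.+1))) //.
  by move=> i iu; rewrite nth_mkseq.
exact: off_ge.
Qed.

Local Notation sampleT := (measurableTypeR R).

(** Whether [u] and [v] are adjacent is decided by the first [u + 1] digits, since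
every block has at least one node. *)
Lemma measurable_coded_graph :
  measurable_fun [set: sampleT] (coded_graph : sampleT -> rooted_graphM).
Proof.
apply: (@measurability _ _ sampleT rooted_graphM setT coded_graph rooted_graph_events) => //.
move=> _ [B [u [v hB]] <-]; rewrite setTI.
case: hB => ->.
- case: (eqVneq 0%N v) => [<-|/eqP v0].
    by rewrite (_ : _ @^-1` _ = setT) //; apply/seteqP; split.
  by rewrite (_ : _ @^-1` _ = set0) //; apply/seteqP; split.
- by rewrite (_ : _ @^-1` _ = setT) //; apply/seteqP; split.
- rewrite (_ : _ @^-1` _ = [set x | v \in nb (nth digit0 (mkseq (digit_at x) u.+1)) u]).
    exact: (@measurable_prefix u.+1 (fun w => v \in nb (nth digit0 w) u)).
  by apply/seteqP; split => x; rewrite /preimage /= -adj_coded_graph.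
Qed.

Definition coded_graphM : sampleT -> rooted_graphM := coded_graph.

HB.instance Definition _ :=
  @isMeasurableFun.Build _ _ sampleT rooted_graphM coded_graphM measurable_coded_graph.

Let unit_itv : set sampleT := `[0, 1[%classic.
Let m_unit_itv : measurable unit_itv. Proof. exact: measurable_itv. Qed.

Definition unit_lebesgue := mrestr (@lebesgue_measure R) m_unit_itv.

HB.instance Definition _ := Measure.on unit_lebesgue.

Let unit_lebesgue_setT : unit_lebesgue setT = 1%E.
Proof.
rewrite /unit_lebesgue /mrestr setTI /unit_itv lebesgue_measure_itv /= lte_fin ltr01.
by rewrite -EFinB subr0.
Qed.

HB.instance Definition _ :=
  Measure_isProbability.Build _ _ _ unit_lebesgue unit_lebesgue_setT.

Definition limit_law : probability rooted_graphM R :=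
  distribution unit_lebesgue coded_graphM.

Lemma limit_lawE (A : set rooted_graph) : limit_law A = unit_lebesgue (coded_graph @^-1` A).
Proof. by []. Qed.

Lemma unit_lebesgue_coded w : unit_lebesgue [set x | coded 0 w x] = (word_mass 0 w)%:E.
Proof.
rewrite /unit_lebesgue /mrestr.
rewrite (_ : _ `&` _ = `[left_end 0 w, left_end 0 w + word_mass 0 w[%classic).
  rewrite lebesgue_measure_itv /= lte_fin ltrDl lt0r word_mass_ge0 andbT.
  by case: eqVneq => [->|_] //=; rewrite -EFinB addrAC subrr add0r.
apply/seteqP; split=> x /=; first by case; rewrite in_itv.
by rewrite in_itv /= => c; split => //; rewrite /unit_itv /= in_itv; apply: coded01 c.
Qed.

Lemma digits_of_mkseq D m i : (i < m)%N -> digits_of (mkseq D m) i = D i.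
Proof. by move=> im; rewrite /digits_of nth_mkseq. Qed.

Section BallEvents.
Variables (r : nat) (F : rooted_graph).

Definition good_word (w : seq digit) : bool :=
  `[< riso F (rball (limit_graph (digits_of w)) r) >].

Lemma ball_event : coded_graph @^-1` [set H | riso F (rball H r)] =
  [set x | good_word (mkseq (digit_at x) r.+1)].
Proof.
apply/seteqP; split => x /= h; [apply/asboolP|move/asboolP in h];
  apply: limit_ball_prefix h => i ir; by rewrite digits_of_mkseq.
Qed.

(** Words of equal length code disjoint intervals. *)
Lemma good_word_mass (s : seq (seq digit)) (b : bool) :
  uniq s -> (forall w, w \in s -> size w = r.+1) ->
  ((\sum_(w <- s | good_word w == b) word_mass 0 w)%:E <=
   unit_lebesgue [set x | good_word (mkseq (digit_at x) r.+1) == b])%E.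
Proof.
move=> us ss; pose s' := [seq w <- s | good_word w == b].
have us' : uniq s' by rewrite filter_uniq.
rewrite -big_filter -/s' -sumEFin.
under eq_bigr do rewrite -unit_lebesgue_coded.
rewrite fsbig_seq // -measure_fin_bigcup //; last 2 first.
- move=> w w' /= ws ws' [x [/= c c']]; apply: (coded_unique _ c c').
  by rewrite !ss //; move: ws ws'; rewrite !mem_filter => /andP[_ ?] /andP[_ ?].
- by move=> w _; apply: measurable_coded.
apply: le_measure; rewrite ?inE.
- apply: fin_bigcup_measurable; first exact: finite_seq.
  by move=> w _; apply: measurable_coded.
- exact: (@measurable_prefix r.+1 (fun w => good_word w == b)).
- move=> x [w /=]; rewrite mem_filter => /andP[gw ws] c.
  suff -> : mkseq (digit_at x) r.+1 = w by [].
  apply: (@eq_from_nth _ digit0); rewrite size_mkseq ?ss // => i ir.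
  by rewrite nth_mkseq // (digit_at_coded c) // ss.
Qed.

Lemma limit_ball_prob_bounds (s : seq (seq digit)) :
  uniq s -> (forall w, w \in s -> size w = r.+1) ->
  \sum_(w <- s | good_word w) word_mass 0 w <= ball_prob r F limit_law /\
  ball_prob r F limit_law <= 1 - \sum_(w <- s | ~~ good_word w) word_mass 0 w.
Proof.
move=> us ss; have h1 := good_word_mass true us ss; have h2 := good_word_mass false us ss.
rewrite /ball_prob.
have -> : limit_law [set H | riso F (rball H r)] =
          unit_lebesgue [set x | good_word (mkseq (digit_at x) r.+1)].
  by rewrite -ball_event.
have e1 : [set x | good_word (mkseq (digit_at x) r.+1) == true] =
          [set x | good_word (mkseq (digit_at x) r.+1)].
  by apply/seteqP; split => x /= /eqP.
have e2 : [set x | good_word (mkseq (digit_at x) r.+1) == false] =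
          ~` [set x | good_word (mkseq (digit_at x) r.+1)].
  by apply/seteqP; split => x /=; [move/eqP => -> | move/negP/negPf/eqP].
have mG := @measurable_prefix r.+1 good_word.
rewrite e1 in h1; rewrite e2 in h2; rewrite (probability_setC unit_lebesgue mG) in h2.
have b1 : \sum_(w <- s | good_word w == true) word_mass 0 w = \sum_(w <- s | good_word w) word_mass 0 w.
  by apply: eq_bigl => w; rewrite eqb_id.
have b2 : \sum_(w <- s | good_word w == false) word_mass 0 w = \sum_(w <- s | ~~ good_word w) word_mass 0 w.
  by apply: eq_bigl => w; rewrite eqbF_neg.
rewrite b1 in h1; rewrite b2 in h2.
have fin : unit_lebesgue [set x | good_word (mkseq (digit_at x) r.+1)] \is a fin_num.
  exact: fin_num_measure.
split; first by rewrite -lee_fin fineK.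
have : \sum_(w <- s | ~~ good_word w) word_mass 0 w <=
    1 - fine (unit_lebesgue [set x | good_word (mkseq (digit_at x) r.+1)]).
  by rewrite -lee_fin EFinB fineK.
lra.
Qed.

End BallEvents.

Lemma measurable_adj_path (u : nat) (p : seq nat) :
  measurable ([set H : rooted_graph | path (adj H) u p] : set rooted_graphM).
Proof.
elim: p u => [|v p IH] u.
  by rewrite (_ : [set H | _] = setT) //; apply/seteqP; split.
have -> : [set H : rooted_graph | path (adj H) u (v :: p)] =
    [set H : rooted_graph | adj H u v] `&` [set H : rooted_graph | path (adj H) v p].
  by apply/seteqP; split => H /= => [/andP[]|[-> ->]].
apply: measurableI; last exact: IH.
by apply: sub_sigma_algebra; exists u, v; apply: Or33.
Qed.

Lemma measurable_forall d (T : measurableType d) (I : countType) (F : I -> set T) :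
  (forall i, measurable (F i)) -> measurable [set x | forall i, F i x].
Proof.
move=> mF; rewrite (_ : [set x | _] = ~` [set x | exists i, (~` F i) x]).
  by apply: measurableC; apply: measurable_exists => i; apply: measurableC.
apply/seteqP; split => x /=; first by move=> h [i]; apply.
by move=> h i; apply: contrapT => nF; apply: h; exists i.
Qed.

(** The limit graph is an infinite tree for every real; what has to be checked is
that infinite trees contain a measurable set of full measure. *)
Lemma limit_law_tree : {ae limit_law, forall H, infinite_rooted_tree H}.
Proof.
pose B := [set H : rooted_graph | forall v, nodes H v] `&`
  [set H : rooted_graph | forall u v, exists p, last u p = v /\ path (adj H) u p] `&`
  [set H : rooted_graph | forall c, ~ ((2 < size c)%N && uniq c /\ cycle (adj H) c)].
have mB : measurable (B : set rooted_graphM).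
  apply: measurableI; first apply: measurableI.
  - apply: measurable_forall => v; apply: sub_sigma_algebra.
    by exists v, v; apply: Or32.
  - apply: measurable_forall => u; apply: measurable_forall => v.
    apply: measurable_exists => p; apply: measurable_and_prop; exact: measurable_adj_path.
  - apply: measurable_forall => c; apply: measurableC; apply: measurable_and_prop.
    case: c => [|x c]; last exact: measurable_adj_path.
    by rewrite (_ : (fun H => _) = setT) //; apply/seteqP; split.
exists (~` B); split; first exact: measurableC.
  rewrite limit_lawE (_ : _ @^-1` _ = set0) ?measure0 //.
  apply/seteqP; split => // x; apply.
  have [_ [_ hc ha]] := limit_graph_tree (digit_at x).
  split; first split => //=.
  - by move=> u v; have [p p1 p2] := hc u v I I; exists p.
  - by move=> c [/andP[sc uc] cc]; apply: (ha c sc); apply/andP.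
move=> H nT hB; apply: nT.
have [[h1 h2] h3] := hB; split.
  by rewrite (_ : nodes H = setT); [exact: infinite_nat | apply/seteqP; split].
split; first by exists 0%N; exact: h1.
- by move=> u v _ _; have [p [p1 p2]] := h2 u v; exists p.
- by move=> c sc /andP[cc uc]; apply: (h3 c); rewrite sc uc.
Qed.

End Coding.

(** * Second moments and convergence *)
Lemma total_weight_fact n : (2 <= n)%N -> (total_weight n * (2 * n - 1)`! = (3 * n - 3)`!)%N.
Proof.
move=> n2; rewrite /total_weight [((n - 2)`! * _)%N]mulnC bin_ffact.
have -> : (2 * n - 1 = 3 * n - 3 - (n - 2))%N by lia.
by apply: ffact_fact; lia.
Qed.

Lemma total_weight_gt0 n : (2 <= n)%N -> (0 < total_weight n)%N.
Proof. by move=> n2; rewrite /total_weight muln_gt0 fact_gt0 bin_gt0; lia. Qed.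

Lemma total_weightS n : (2 <= n)%N ->
  (total_weight n.+1 * ((2 * n).+1 * (2 * n)) = total_weight n * (3 * n * (3 * n - 1) * (3 * n - 2)))%N.
Proof.
move=> n2; have h1 := total_weight_fact n2; have h2 := @total_weight_fact n.+1 (ltnW n2).
have e1 : (2 * n.+1 - 1 = (2 * n - 1).+2)%N by lia.
have e2 : (3 * n.+1 - 3 = (3 * n - 3).+3)%N by lia.
move: h2; rewrite e1 e2 !factS -h1.
have -> : ((2 * n - 1).+2 = (2 * n).+1)%N by lia.
have -> : ((2 * n - 1).+1 = 2 * n)%N by lia.
have -> : ((3 * n - 3).+3 = 3 * n)%N by lia.
have -> : ((3 * n - 3).+2 = 3 * n - 1)%N by lia.
have -> : ((3 * n - 3).+1 = 3 * n - 2)%N by lia.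
move=> h; apply/eqP; rewrite -(eqn_pmul2r (fact_gt0 (2 * n - 1))); apply/eqP.
move: h; move: (total_weight n) (total_weight n.+1) ((2 * n - 1)`!) (2 * n)%N (3 * n - 1)%N (3 * n - 2)%N (3 * n)%N.
by move=> a b c d e f g h; lia.
Qed.

Section Asymptotics.
Variable R : realType.
Local Open Scope ring_scope.
Notation node_mass := (node_mass R).

(** By [total_weightS] this is 4 (3n) (3n-1) (3n-2) <= 27 (n+1) (2n+1) (2n); the
limit of the ratio is approached from the favourable side, so that no error
term appears. *)
Lemma total_weight_step n : (2 <= n)%N -> node_mass * (total_weight n.+1)%:R <= n.+1%:R * (total_weight n)%:R.
Proof.
move=> n2; have := total_weightS n2; move: (total_weight n) (total_weight n.+1) => A B /(congr1 (fun k : nat => k%:R : R)).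
rewrite !natrM !natrB ?natrM; [|lia..].
rewrite -[n.+1%:R]natr1 -[(2 * n).+1%:R]natr1 natrM.
have : (2 : R) <= n%:R by rewrite ler_nat.
have : 0 <= A%:R :> R by [].
move: A%:R B%:R n%:R => a b x a0 x2 e.
have x0 : 0 < (2 * x + 1) * (2 * x) by apply: mulr_gt0; lra.
rewrite -(ler_pM2r x0) -[node_mass * b * _]mulrA e /node_mass.
have -> : 4 / 27 * (a * (3 * x * (3 * x - 1) * (3 * x - 2))) =
  a * (4 / 27 * (3 * x * (3 * x - 1) * (3 * x - 2))) by lra.
have -> : (x + 1) * a * ((2 * x + 1) * (2 * x)) = a * ((x + 1) * ((2 * x + 1) * (2 * x))) by lra.
apply: ler_wpM2l => //.
have : 0 <= x ^+ 2 by apply: exprn_ge0; lra.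
have : 0 <= x * x by apply: mulr_ge0; lra.
lra.
Qed.

Lemma ffact_total_weight n k : (k + 2 <= n)%N -> node_mass ^+ k * (total_weight n)%:R <= (n ^_ k)%:R * (total_weight (n - k))%:R.
Proof.
elim: k => [|k IH] kn; first by rewrite expr0 ffactn0 !mul1r subn0.
have {}IH := IH (ltnW kn).
have e : (n - k = (n - k.+1).+1)%N by lia.
have := @total_weight_step (n - k.+1) ltac:(lia); rewrite -e => st.
rewrite ffactnSr natrM -mulrA.
apply: (le_trans _ (ler_wpM2l (ler0n _ (n ^_ k)) st)).
rewrite exprS mulrCA -mulrA; apply: ler_wpM2l; first exact: node_mass_ge0.
exact: IH.
Qed.

(** Use (3(n-k) - 2)^2 >= 9 n^2 - 6 (3k + 2) n and 6 (3k + 2) <= 9 (4K + 2). *)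
Lemma pair_bound n k K : (k + 2 <= n)%N -> (k <= 2 * K)%N ->
  9 * node_mass ^+ k * (1 - (4 * K + 2)%:R / n%:R) * n%:R ^+ 2 * (total_weight n)%:R <=
  (n ^_ k * (total_weight (n - k) * (3 * (n - k) - 2) ^ 2))%:R.
Proof.
move=> kn kK; have n0 : 0 < n%:R :> R by rewrite ltr0n; lia.
rewrite mulnA natrM natrM.
have h := ffact_total_weight kn.
have s : (9 * n%:R ^+ 2 - 9 * (4 * K + 2)%:R * n%:R : R) <= ((3 * (n - k) - 2) ^ 2)%:R.
  rewrite natrX natrB; last lia.
  rewrite natrM natrB; last lia.
  have kK' : k%:R <= 2 * K%:R :> R by rewrite -natrM ler_nat.
  rewrite natrD natrM; move: n0 kK'; move: n%:R k%:R K%:R => x y z x0 yz.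
  have : 0 <= (3 * y + 2) ^+ 2 by apply: sqr_ge0.
  have : 0 <= x * (2 * z - y) by apply: mulr_ge0; lra.
  lra.
apply: (le_trans _ (ler_wpM2r (ler0n _ _) h)).
have -> : 9 * node_mass ^+ k * (1 - (4 * K + 2)%:R / n%:R) * n%:R ^+ 2 * (total_weight n)%:R =
  node_mass ^+ k * (total_weight n)%:R * (9 * n%:R ^+ 2 - 9 * (4 * K + 2)%:R * n%:R).
  have -> : 9 * n%:R ^+ 2 - 9 * (4 * K + 2)%:R * n%:R =
      9 * (1 - (4 * K + 2)%:R / n%:R) * n%:R ^+ 2 :> R.
    have e : (4 * K + 2)%:R / n%:R * n%:R = (4 * K + 2)%:R :> R by rewrite divfK // gt_eqF.
    move: e; move: ((4 * K + 2)%:R / n%:R) => y <-; lra.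
  move: (1 - _) (node_mass ^+ k) (n%:R ^+ 2) (total_weight n)%:R => a b c d; lra.
by apply: ler_wpM2l => //; apply: mulr_ge0 => //; apply: exprn_ge0; exact: node_mass_ge0.
Qed.

(** Here p^2 = 1 - 2 p (1 - p) - (1 - p)^2 and p = p^2 + p (1 - p): lower bounds on
products turn into an upper bound on the square. *)
Lemma square_deviation_le (x y p rho : R) :
  0 <= x -> 0 <= y -> 0 <= rho -> x <= p -> y <= 1 - p ->
  (p - rho) ^+ 2 <= 1 + rho ^+ 2 - (2 * (x * y) + y * y + 2 * rho * (x * x + x * y)).
Proof.
move=> x0 y0 r0 xp yp.
have xy : x * y <= p * (1 - p) by apply: ler_pM.
have yy : y * y <= (1 - p) * (1 - p) by apply: ler_pM.
have xx : x * x <= p * p by apply: ler_pM.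
have rx : rho * (x * x + x * y) <= rho * (p * p + p * (1 - p)).
  by apply: ler_wpM2l => //; lra.
lra.
Qed.

(** With s = alpha + beta and t = 1 - s, the value at gam = 0 is
1 - s^2 + (rho - alpha)^2 + 2 rho alpha t, which is at most 5 t. *)
Lemma second_moment_arith (alpha beta rho delta gam W xab xbb xaa : R) :
  0 <= alpha -> 0 <= beta -> alpha <= rho -> rho <= 1 - beta ->
  1 - delta <= alpha + beta -> 0 <= gam -> 0 <= W ->
  alpha * beta * (1 - gam) * W <= xab ->
  beta * beta * (1 - gam) * W <= xbb ->
  alpha * alpha * (1 - gam) * W <= xaa ->
  (1 + rho ^+ 2) * W - (2 * xab + xbb + 2 * rho * (xaa + xab)) <=
  (5 * delta + 5 * gam) * W.
Proof.
move=> a0 b0 alpha_rho rho_beta mass_delta gam0 W0 sab sbb saa.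
have r0 : 0 <= rho by lra.
have r1 : rho <= 1 by lra.
have rr : 2 * rho * ((alpha * alpha + alpha * beta) * (1 - gam) * W) <= 2 * rho * (xaa + xab).
  by apply: ler_wpM2l; lra.
apply: (@le_trans _ _ ((1 + rho ^+ 2 - (2 * (alpha * beta) + beta * beta +
    2 * rho * (alpha * alpha + alpha * beta)) * (1 - gam)) * W)); first lra.
apply: ler_wpM2r => // {W W0 sab sbb saa rr xab xbb xaa}.
have ab1 : alpha + beta <= 1 by lra.
have [t tE] : exists t, t = 1 - (alpha + beta) by exists (1 - (alpha + beta)).
have t0 : 0 <= t by lra.
have t1 : t <= 1 by lra.
have td : t <= delta by lra.
have ra0 : 0 <= rho - alpha by lra.
have bb : beta * beta <= beta by rewrite ler_piMr //; lra.
have abs : alpha * beta <= beta by rewrite ler_piMl //; lra.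
have sqt : (rho - alpha) * (rho - alpha) <= t * 1 by apply: ler_pM => //; lra.
have sq2 : rho * alpha <= 1 * 1 by apply: ler_pM => //; lra.
have rat2 : rho * alpha * t <= 1 * t by apply: ler_wpM2r => //; lra.
have tt : 0 <= t * t by apply: mulr_ge0.
have Z : alpha * (alpha + beta) <= 1 * 1 by apply: ler_pM => //; lra.
have Z0 : 0 <= alpha * (alpha + beta) by apply: mulr_ge0 => //; lra.
have rZ : rho * (alpha * (alpha + beta)) <= 1 * 1 by apply: ler_pM => //; lra.
have Y : 2 * (alpha * beta) + beta * beta + 2 * rho * (alpha * alpha + alpha * beta) <= 5 by lra.
have Yg := ler_wpM2r gam0 Y.
have main : 1 + rho ^+ 2 - (2 * (alpha * beta) + beta * beta +
    2 * rho * (alpha * alpha + alpha * beta)) <= 5 * t.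
  have -> : beta = 1 - t - alpha by lra.
  lra.
lra.
Qed.

Section SecondMoment.
Variables (r K : nat) (F : rooted_graph) (s : seq (seq digit)).
Hypothesis us : uniq s.
Hypothesis ss : forall w, w \in s -> size w = r.+1.
Hypothesis sv : forall w, w \in s -> valid_first (digits_of w 0).
Hypothesis sK : forall w, w \in s -> (pattern_size w <= K)%N.
Hypothesis dtW : forall n, (2 <= n)%N -> size (dtrees (iota 1 n)) = total_weight n.
Variable n : nat.
Hypothesis nK : (2 * K + 2 <= n)%N.
Let V := iota 1 n.

Definition occurrences_sum (Q : pred (seq digit)) (sg : adjacency) : nat :=
  \sum_(w <- s | Q w) occurrences sg n w.

(** For words of sizes k and k', the number of labels used is k + k' <= 2 K, and
[word_mass] is 3 (4/27)^k, whence the factor 9 of [pair_bound]. *)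
Lemma occurrences_sum_pair Q Q' :
  (\sum_(w <- s | Q w) word_mass R 0 w) * (\sum_(w <- s | Q' w) word_mass R 0 w) *
  (1 - (4 * K + 2)%:R / n%:R) * n%:R ^+ 2 * (total_weight n)%:R <=
  \sum_(sg <- dtrees V) (occurrences_sum Q sg)%:R * (occurrences_sum Q' sg)%:R.
Proof.
rewrite /occurrences_sum.
under [leRHS]eq_bigr do rewrite !natr_sum mulr_suml.
rewrite exchange_big /= !mulr_suml big_seq_cond [leRHS]big_seq_cond.
apply: ler_sum => w /andP[ws Qw].
under [leRHS]eq_bigr do rewrite mulr_sumr.
rewrite exchange_big /= mulr_sumr !mulr_suml big_seq_cond [leRHS]big_seq_cond.
apply: ler_sum => w' /andP[ws' Qw'].
have wK := sK ws; have wK' := sK ws'.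
have z : (0 < size w)%N by rewrite ss.
have z' : (0 < size w')%N by rewrite ss.
have := @occurrences_pair n w w' z z' (sv ws) (sv ws') ltac:(lia) ltac:(lia).
rewrite dtW; last lia.
rewrite -(ler_nat R) natr_sum => h.
under [leRHS]eq_bigr do rewrite -natrM.
apply: le_trans h; apply: le_trans (pair_bound (K := K) _ _); [|lia|lia].
rewrite !word_mass_valid ?sv // exprD.
move: (node_mass ^+ pattern_size w) (node_mass ^+ pattern_size w') (1 - _) (n%:R ^+ 2) (total_weight n)%:R => a b c d e.
rewrite le_eqVlt; apply/orP; left; apply/eqP; lra.
Qed.

Definition ball_at (G : sgraph) (v : nat) : Prop :=
  exists Gv : nodes G v, riso F (rball (RootedGraph Gv) r).

Definition ball_count (sg : adjacency) : nat :=
  count (fun v => `[< ball_at (tree_of n sg) v >]) V.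

Lemma ball_prob_tree sg :
  ball_prob r F (unif_root R (tree_of n sg)) = (ball_count sg)%:R / n%:R.
Proof.
rewrite /ball_prob /unif_root /=; congr (_%:R / _%:R).
  rewrite /ball_count -size_filter.
  apply: card_fset_set_seq; first by rewrite filter_uniq // iota_uniq.
  move=> v; rewrite mem_filter; split => [[Gv h]|/andP[/asboolP[Gv h] _]]; last by exists Gv.
  by apply/andP; split; [apply/asboolP; exists Gv | exact: Gv].
rewrite (@card_fset_set_seq _ (iota 1 n)) ?size_iota ?iota_uniq //.
Qed.

Lemma occurs_ball sg w v : dtree V sg -> size w = r.+1 -> occurs sg w v ->
  ball_at (tree_of n sg) v <-> good_word r F w.
Proof.
move=> T sw [phi pv [inj e]].
have M0 : (0 < pattern_size w)%N by apply: pattern_size_gt0; rewrite sw.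
have vV : nodes (tree_of n sg) v.
  have h : off (digits_of w) 1 \in nb (digits_of w) (off (digits_of w) 0).
    by rewrite (nb_next (off_ltS (digits_of w) 0)).
  by rewrite -pv /=; apply: (dt_in (y := phi (off (digits_of w) 1)) T); rewrite e // map_f.
have iso (Gv : nodes (tree_of n sg) v) :
    riso (rball (limit_graph (digits_of w)) r) (rball (RootedGraph Gv) r).
  apply: (@ball_iso (digits_of w) r (RootedGraph Gv) phi).
  - by move=> j k; rewrite -sw; apply: inj.
  - exact: pv.
  - by move=> j x; rewrite -sw => jM; rewrite [LHS](dtree_adj _ _ T) e.
split=> [[Gv h]|/asboolP h].
  by apply/asboolP; apply: riso_trans h _; apply: riso_sym.
by exists vV; apply: riso_trans h _.
Qed.

(** At most one pattern of the family occurs at a given node. *)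
Lemma sum_occurrences_le (Q : pred (seq digit)) (B : pred nat) sg : sg \in dtrees V ->
  (forall w v, w \in s -> Q w -> occurs sg w v -> B v) ->
  (occurrences_sum Q sg <= count B V)%N.
Proof.
rewrite mem_dtrees ?iota_uniq // => /asboolP T h; rewrite /occurrences_sum /occurrences.
under eq_bigr do rewrite -sum_bool_count.
rewrite exchange_big /= -sum_bool_count; apply: leq_sum => v _.
pose s' := [seq w <- s | Q w && `[< occurs sg w v >]].
have -> : (\sum_(w <- s | Q w) `[< occurs sg w v >] = size s')%N.
  rewrite size_filter -sum1_count big_mkcondr /=; apply: eq_bigr => w _.
  by case: asboolP.
have s'P w : w \in s' -> [/\ w \in s, Q w & occurs sg w v].
  by rewrite mem_filter => /andP[/andP[? /asboolP ?] ?].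
have us' : uniq s' by rewrite filter_uniq.
case E : s' us' s'P => [|w l] //= => /andP[wl _] s'P.
have [ws Qw wv] := s'P w (mem_head _ _).
rewrite (h w v ws Qw wv); case: l E wl s'P => //= w' l E wl s'P; exfalso.
have [|ws' _ wv'] := s'P w'; first by rewrite !inE eqxx orbT.
move: wl; rewrite inE negb_or => /andP[/eqP ww' _]; apply: ww'.
have [phi p0 E1] := wv; have [phi' p0' E2] := wv'.
have sww : size w = size w' by rewrite !ss.
have wK := sK ws; have wK' := sK ws'.
rewrite /pattern_size in wK wK'; rewrite /pattern_size in E1 E2.
have [|||dd _] := pattern_unique (m := size w) T _ (iota_uniq _ _) (sv ws) (sv ws') E1 _ (etrans p0 (esym p0')).
- by rewrite ss.
- by rewrite sww.
- by rewrite sww size_iota -{1}sww; lia.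
apply: (@eq_from_nth _ digit0) => // i iw; exact: dd.
Qed.

Variables (rho delta : R).
Let alpha := \sum_(w <- s | good_word r F w) word_mass R 0 w.
Let beta := \sum_(w <- s | ~~ good_word r F w) word_mass R 0 w.
Hypothesis alpha_rho : alpha <= rho.
Hypothesis rho_beta : rho <= 1 - beta.
Hypothesis mass_delta : 1 - delta <= alpha + beta.

Lemma second_moment :
  \sum_(sg <- dtrees V) ((ball_count sg)%:R / n%:R - rho) ^+ 2 <=
  (5 * delta + 5 * ((4 * K + 2)%:R / n%:R)) * (total_weight n)%:R.
Proof.
pose a sg : R := (occurrences_sum (good_word r F) sg)%:R.
pose b sg : R := (occurrences_sum (fun w => ~~ good_word r F w) sg)%:R.
set gam := (4 * K + 2)%:R / n%:R.
have a0 : 0 <= alpha by apply: sumr_ge0 => w _; apply: word_mass_ge0.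
have b0 : 0 <= beta by apply: sumr_ge0 => w _; apply: word_mass_ge0.
have N0 : 0 < n%:R :> R by rewrite ltr0n; lia.
have N2 : 0 < n%:R ^+ 2 :> R by apply: exprn_gt0.
have mean Q Q' : (\sum_(w <- s | Q w) word_mass R 0 w) * (\sum_(w <- s | Q' w) word_mass R 0 w) *
    (1 - gam) * (total_weight n)%:R <=
    (\sum_(sg <- dtrees V) (occurrences_sum Q sg)%:R * (occurrences_sum Q' sg)%:R) / n%:R ^+ 2.
  by rewrite ler_pdivlMr // mulrAC; apply: occurrences_sum_pair.
have ptw sg : sg \in dtrees V ->
   ((ball_count sg)%:R / n%:R - rho) ^+ 2 <=
   1 + rho ^+ 2 - (2 * (a sg * b sg) + b sg * b sg + 2 * rho * (a sg * a sg + a sg * b sg)) / n%:R ^+ 2.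
  move=> sgD; have T : dtree V sg by move: sgD; rewrite mem_dtrees ?iota_uniq // => /asboolP.
  have la : a sg <= (ball_count sg)%:R.
    rewrite ler_nat; apply: sum_occurrences_le => // w v ws gw o.
    by apply/asboolP; apply/(occurs_ball T (ss ws) o).
  have lb : b sg <= n%:R - (ball_count sg)%:R.
    have e : (n = ball_count sg + count (predC (fun v => `[< ball_at (tree_of n sg) v >])) V)%N.
      by rewrite count_predC size_iota.
    rewrite lerBrDl -natrD ler_nat [leqRHS]e.
    rewrite leq_add2l; apply: sum_occurrences_le => // w v ws gw o /=.
    by apply/asboolPn => /(occurs_ball T (ss ws) o); apply/negP.
  rewrite (_ : _ / n%:R ^+ 2 = 2 * (a sg / n%:R * (b sg / n%:R)) + b sg / n%:R * (b sg / n%:R) +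
    2 * rho * (a sg / n%:R * (a sg / n%:R) + a sg / n%:R * (b sg / n%:R))); last first.
    by rewrite expr2 invfM; move: (a sg) (b sg) (n%:R^-1) => x y i; lra.
  apply: square_deviation_le.
  - by rewrite divr_ge0.
  - by rewrite divr_ge0.
  - exact: le_trans a0 alpha_rho.
  - by rewrite ler_pM2r // invr_gt0.
  - have -> : 1 - (ball_count sg)%:R / n%:R = (n%:R - (ball_count sg)%:R) / n%:R :> R.
      by rewrite mulrBl divff // gt_eqF.
    by rewrite ler_pM2r // invr_gt0.
apply: (@le_trans _ _ (\sum_(sg <- dtrees V) (1 + rho ^+ 2 -
    (2 * (a sg * b sg) + b sg * b sg + 2 * rho * (a sg * a sg + a sg * b sg)) / n%:R ^+ 2))).
  by rewrite big_seq [leRHS]big_seq; apply: ler_sum => sg; apply: ptw.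
rewrite sumrB big_const_seq count_predT iter_addr_0 dtW; last by lia.
have alg (u v w i t : R) : (2 * u + v + 2 * t * (w + u)) * i =
    2 * (u * i) + v * i + 2 * t * (w * i + u * i) by lra.
rewrite -mulr_suml !big_split /= -!mulr_sumr big_split /= alg -[X in X - _]mulr_natr.
apply: (@second_moment_arith alpha beta) => //.
- by rewrite divr_ge0.
- exact: (mean (good_word r F) (fun w => ~~ good_word r F w)).
- exact: (mean (fun w => ~~ good_word r F w) (fun w => ~~ good_word r F w)).
- exact: (mean (good_word r F) (good_word r F)).
Qed.

Lemma deviation_count (eps : R) : 0 < eps ->
  (count (fun sg => eps < `|(ball_count sg)%:R / n%:R - rho|) (dtrees V))%:R * eps ^+ 2 <=
  (5 * delta + 5 * ((4 * K + 2)%:R / n%:R)) * (total_weight n)%:R.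
Proof.
move=> eps0; apply: le_trans second_moment.
rewrite -sum_bool_count natr_sum mulr_suml; apply: ler_sum => sg _.
case: ltP => [h|_] /=; last by rewrite mul0r sqr_ge0.
by rewrite mul1r -[leRHS]real_normK ?num_real // ler_sqr ?nnegrE // ltW.
Qed.

End SecondMoment.

End Asymptotics.

Local Open Scope ring_scope.

Theorem theorem1 (R : realType) (d : nat -> measure_display)
    (Omega : forall n, measurableType (d n))
    (P : forall n, probability (Omega n) R)
    (X : forall n, Omega n -> sgraph)
    (hX : forall n, (2 <= n)%N -> random_Pi_tree n (P n) (X n)) :
  exists rho : probability rooted_graphM R,
    {ae rho, forall H, infinite_rooted_tree H} /\
    has_random_local_limit P X rho.
Proof.
exists (limit_law R); split; first exact: limit_law_tree.
move=> r F eps r0 _ eps0.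
have dtW n : (2 <= n)%N -> size (dtrees (iota 1 n)) = total_weight n.
  by move=> n2; exact: (size_dtrees n2 (hX n n2)).
set rho := ball_prob r F (limit_law R).
pose dev (G : sgraph) : Prop := eps < `|ball_prob r F (unif_root R G) - rho|.
have devE n : (2 <= n)%N -> P n [set w | dev (X n w)] =
    ((count (fun sg => eps < `|(ball_count r F n sg)%:R / n%:R - rho|) (dtrees (iota 1 n)))%:R
      / (total_weight n)%:R)%:E.
  move=> n2; rewrite (random_tree_law n2 (hX n n2) dev); congr ((_%:R / _)%:E).
  apply: eq_count => sg; rewrite /dev ball_prob_tree.
  by apply/asboolP/idP.
apply/fine_cvgP; split.
  by exists 2%N => // n /= n2; rewrite devE.
apply/cvgr0Pnorm_le => e e0.
(* for large [n] the bound 5 delta + O(1/n) is at most 10 delta = e eps^2 *)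
pose delta := e * eps ^+ 2 / 10.
have eps2 : 0 < eps ^+ 2 by apply: exprn_gt0.
have delta0 : 0 < delta by rewrite /delta divr_gt0 // mulr_gt0.
have [h hh] := words_near1 r.+1 delta0.
pose s := [seq w <- words (digits h) r.+1 | valid_first (digits_of w 0)].
have us : uniq s by rewrite filter_uniq // words_uniq // digits_uniq.
have ss w : w \in s -> size w = r.+1 by rewrite mem_filter => /andP[_ /mem_words].
have sv w : w \in s -> valid_first (digits_of w 0) by rewrite mem_filter => /andP[].
have [al be] := limit_ball_prob_bounds R F us ss.
have mass : 1 - delta <= \sum_(w <- s | good_word r F w) word_mass R 0 w +
    \sum_(w <- s | ~~ good_word r F w) word_mass R 0 w.
  apply: le_trans hh _; rewrite -(bigID (good_word r F) predT) big_filter [leRHS]big_mkcond.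
  rewrite big_seq [leRHS]big_seq; apply: ler_sum => w /mem_words sw.
  by case: ifPn => // /word_mass_invalid ->; rewrite ?sw.
pose K := \max_(w <- s) pattern_size w.
have sK w : w \in s -> (pattern_size w <= K)%N by move=> ws; apply: leq_bigmax_seq.
have [N hN] : exists N : nat, (4 * K + 2)%:R / delta < N%:R.
  exists (Num.bound ((4 * K + 2)%:R / delta)); apply: archi_boundP.
  by apply: divr_ge0 => //; exact: ltW.
exists (maxn N (2 * K + 2)) => // n /= nN.
have /andP[Nn nK] : (N <= n)%N && (2 * K + 2 <= n)%N by rewrite -geq_max.
have n2 : (2 <= n)%N := leq_trans (leq_addl _ _) nK.
have W0 : 0 < (total_weight n)%:R :> R by rewrite ltr0n total_weight_gt0.
rewrite devE //= ger0_norm ?divr_ge0 // ler_pdivrMr //.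
have := deviation_count us ss sv sK dtW nK al be mass eps0.
have n0 : 0 < n%:R :> R by rewrite ltr0n (leq_trans _ n2).
have gam : (4 * K + 2)%:R / n%:R <= delta.
  rewrite ler_pdivrMr // mulrC -ler_pdivrMr //; apply: ltW; apply: lt_le_trans hN _.
  by rewrite ler_nat.
set c := (count _ _)%:R => hc.
have : c * eps ^+ 2 <= e * (total_weight n)%:R * eps ^+ 2.
  apply: le_trans hc _.
  apply: (@le_trans _ _ (10 * delta * (total_weight n)%:R)); first by apply: ler_wpM2r; [exact: ltW | lra].
  rewrite /delta; lra.
by rewrite ler_pM2r.
Qed.
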